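(* Let $p$ be a prime number, let $(t_n)_{n\ge 0}$ be the Thue--Morse sequence over $\{-1,1\}$, and let $\xi_{\mathbf t,p}=\sum_{n\ge 0} t_n p^n\in\mathbb{Q}_p$. Then $$\mu^{\times}(\xi_{\mathbf t,p})=3\quad\text{and}\quad \widehat{\mu}^{\times}(\xi_{\mathbf t,p})=2.$$ More precisely, there exist positive real numbers $c_1,c_2$ such that: there exist nonzero integers $a,b$ with $|ab|$ arbitrarily large and $$|b\,\xi_{\mathbf t,p}-a|_p<c_1|ab|^{-3/2},$$ while for all nonzero integers $r,s$ we have $$|s\,\xi_{\mathbf t,p}-r|_p>c_2|rs|^{-3/2}.$$
   Context: The Thue--Morse sequence $(t_n)_{n\ge0}$ over $\{-1,1\}$ is defined by $t_0=1$, $t_{2n}=t_n$ and $t_{2n+1}=-t_n$ for $n\ge 0$ (so it begins $1,-1,-1,1,-1,\dots$). $|\cdot|_p$ is the $p$-adic absolute value. For an irrational $p$-adic number $\xi$, the multiplicative irrationality exponent $\mu^{\times}(\xi)$ is the supremum of the real numbers $\mu$ for which $0<|b\xi-a|_p\le (|ab|^{1/2})^{-\mu}$ has infinitely many solutions in nonzero integers $a,b$. The uniform multiplicative irrationality exponent $\widehat{\mu}^{\times}(\xi)$ is the supremum of the real numbers $\widehat\mu$ for which the system $0<|ab|^{1/2}\le X$, $|b\xi-a|_p\le X^{-\widehat\mu}$ has a solution in integers $a,b$ for every sufficiently large real number $X$ (the integers $a,b$ are not required to be coprime). *)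

(* Defs.v *)
From HB Require Import structures.
From mathcomp Require Import all_boot all_order all_algebra.
From mathcomp Require Import generic_quotient ring_quotient.
From mathcomp Require Import all_classical all_reals all_analysis.
From mathcomp Require Import ring zify.

Set Implicit Arguments.
Unset Strict Implicit.
Unset Printing Implicit Defensive.

Import Order.TTheory GRing.Theory Num.Theory.
Import numFieldNormedType.Exports.

Local Open Scope classical_set_scope.
Local Open Scope ring_scope.
Local Open Scope quotient_scope.

(* If p is not prime then logn p = 0, so that ratpnorm is the trivial absolute
   value; this is why the construction below does not assume p prime. *)
Definition padicval (p : nat) (x : rat) : int :=
  (logn p `|numq x|%N)%:Z - (logn p `|denq x|%N)%:Z.

Definition ratpnorm (R : realType) (p : nat) (x : rat) : R :=
  if x == 0 then 0 else p%:R ^ (- padicval p x).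

Section RatPNorm.
Variables (R : realType) (p : nat).
Local Notation N := (ratpnorm R p).
Implicit Types x y : rat.

Lemma padicval_frac (a b : int) : a != 0 -> b != 0 ->
  padicval p (a%:~R / b%:~R) = (logn p `|a|%N)%:Z - (logn p `|b|%N)%:Z.
Proof.
move=> a0 b0; rewrite /padicval; set x := a%:~R / b%:~R.
have x0 : x != 0 by rewrite mulf_neq0 ?invr_eq0 ?intr_eq0.
have e : numq x * b = a * denq x.
  apply: (@intr_inj rat); rewrite !rmorphM /= numqE /x.
  by rewrite mulrAC divfK ?intr_eq0.
have := congr1 (fun z : int => logn p `|z|%N) e.
rewrite /= !abszM !lognM ?absz_gt0 ?numq_eq0 ?denq_neq0 // => h.
by apply/eqP; rewrite subr_eq addrAC eq_sym subr_eq -!PoszD addnC eqz_nat addnC h.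
Qed.

Lemma padicvalM x y : x != 0 -> y != 0 ->
  padicval p (x * y) = padicval p x + padicval p y.
Proof.
move=> x0 y0; rewrite -[x in LHS]divq_num_den -[y in LHS]divq_num_den mulf_div.
rewrite -!rmorphM /= padicval_frac ?mulf_neq0 ?numq_eq0 ?denq_neq0 //.
rewrite !abszM !lognM ?absz_gt0 ?numq_eq0 ?denq_neq0 //.
by rewrite /padicval !PoszD opprD addrACA.
Qed.

Lemma ppow_neq0 : (exists x, padicval p x != 0) -> p%:R != 0 :> R.
Proof.
move=> [x]; apply: contra_neq => /eqP; rewrite pnatr_eq0 => /eqP p0.
have h m : logn p m = 0%N by rewrite lognE p0.
by rewrite /padicval !h subrr.
Qed.

Lemma ratpnorm0 : N 0 = 0. Proof. by rewrite /ratpnorm eqxx. Qed.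

Lemma ratpnorm_eq0 x : (N x == 0) = (x == 0).
Proof.
rewrite /ratpnorm; have [x0|x0] := eqVneq x 0; first exact: eqxx.
apply/negbTE; have [->|v0] := eqVneq (padicval p x) 0.
  by rewrite oppr0 expr0z oner_eq0.
by rewrite expfz_neq0 // ppow_neq0 //; exists x.
Qed.

Lemma ratpnorm_ge0 x : 0 <= N x.
Proof. by rewrite /ratpnorm; case: eqP => // _; rewrite exprz_ge0. Qed.

Lemma ratpnorm1 : N 1 = 1.
Proof.
by rewrite /ratpnorm oner_eq0 /padicval /= logn1 subrr oppr0 expr0z.
Qed.

Lemma ratpnormM x y : N (x * y) = N x * N y.
Proof.
rewrite /ratpnorm mulf_eq0; have [->|x0] := eqVneq x 0; first by rewrite /= mul0r.
have [->|y0] := eqVneq y 0; first by rewrite /= mulr0.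
rewrite /= padicvalM // opprD.
have [p0|p0] := eqVneq (p%:R : R) 0; last by rewrite expfzDr.
have v0 z : padicval p z = 0.
  by apply: contra_eq p0 => vz; apply: ppow_neq0; exists z.
by rewrite !v0 oppr0 addr0 expr0z mulr1.
Qed.

Lemma ratpnormN x : N (- x) = N x.
Proof.
rewrite /ratpnorm oppr_eq0; case: eqP => // _.
by rewrite /padicval numqN denqN abszN.
Qed.

Lemma ratpnormV x : N x^-1 = (N x)^-1.
Proof.
have [->|x0] := eqVneq x 0; first by rewrite invr0 ratpnorm0 invr0.
have nx : N x != 0 by rewrite ratpnorm_eq0.
by apply: (mulfI nx); rewrite -ratpnormM divff // ratpnorm1 divff.
Qed.

Lemma ratpnorm_int_le1 (a : int) : N a%:~R <= 1.
Proof.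
rewrite /ratpnorm; have [_|a0] := eqVneq; first exact: ler01.
rewrite /padicval numq_int denq_int /= logn1 subr0.
have [pr|npr] := boolP (prime p).
  have p0 := prime_gt0 pr.
  by rewrite -exprnN invf_le1 ?exprn_ege1 ?exprn_gt0 ?ler1n ?ltr0n.
by rewrite lognE (negbTE npr) /= oppr0 expr0z.
Qed.

Lemma ratpnorm_le1D1 x : N x <= 1 -> N (1 + x) <= 1.
Proof.
have [->|x0] := eqVneq x 0; first by rewrite addr0 ratpnorm1.
have d0 : (denq x)%:~R != 0 :> rat by rewrite intr_eq0 denq_neq0.
move=> hx; have dx : N (denq x)%:~R = 1.
  rewrite /ratpnorm (negbTE d0) /padicval numq_int denq_int /= logn1 subr0.
  have [pr|npr] := boolP (prime p); last by rewrite lognE (negbTE npr) oppr0 expr0z.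
  move: hx; rewrite /ratpnorm (negbTE x0) /padicval.
  have [->|] := posnP (logn p `|denq x|%N); first by rewrite oppr0 expr0z.
  rewrite -pfactor_dvdn //; last by rewrite absz_gt0 denq_neq0.
  rewrite expn1 => pd.
  have -> : logn p `|numq x|%N = 0%N.
    apply/eqP; rewrite -leqn0 leqNgt logn_gt0 mem_primes; apply/negP.
    case/and3P => _ _ pn; have := coprime_num_den x.
    rewrite /coprime => /eqP g1.
    have : (p %| gcdn `|numq x| `|denq x|)%N by rewrite dvdn_gcd pn pd.
    by rewrite g1 dvdn1 => /eqP p1; rewrite p1 in pr.
  rewrite sub0r opprK -exprnP => le1.
  have lg : (0 < logn p `|denq x|)%N by rewrite logn_gt0 mem_primes pr pd absz_gt0 denq_neq0.
  suff : 1 < (p%:R : R) ^+ logn p `|denq x| by rewrite ltNge le1.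
  by rewrite exprn_egt1 ?ltr1n ?prime_gt1 // -lt0n.
have -> : 1 + x = (denq x + numq x)%:~R / (denq x)%:~R.
  by rewrite rmorphD /= mulrDl divff // divq_num_den.
by rewrite ratpnormM ratpnormV dx invr1 mulr1 ratpnorm_int_le1.
Qed.

Lemma ratpnorm_ultra x y : N (x + y) <= Num.max (N x) (N y).
Proof.
wlog le_yx : x y / N y <= N x.
  move=> h; case/orP: (le_total (N y) (N x)) => /h //.
  by rewrite addrC maxC.
rewrite (max_idPl le_yx); have [x0|x0] := eqVneq x 0.
  by move: le_yx; rewrite x0 ratpnorm0 add0r.
have nx : 0 < N x by rewrite lt_neqAle ratpnorm_ge0 eq_sym ratpnorm_eq0 x0.
have -> : x + y = x * (1 + y / x) by rewrite mulrDr mulr1 mulrCA divff // mulr1.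
rewrite ratpnormM ler_piMr ?ratpnorm_ge0 // ratpnorm_le1D1 //.
by rewrite ratpnormM ratpnormV ler_pdivrMr // mul1r.
Qed.

Lemma ratpnorm_triangle x y : N (x + y) <= N x + N y.
Proof.
apply: le_trans (ratpnorm_ultra x y) _.
by rewrite ge_max lerDl lerDr !ratpnorm_ge0.
Qed.

Lemma ratpnorm_distB x y : `|N x - N y| <= N (x - y).
Proof.
have := ratpnorm_triangle (x - y) y; have := ratpnorm_triangle (y - x) x.
rewrite !subrK -[N (y - x)]ratpnormN opprB => yx xy.
by rewrite ler_norml lerNl opprB !lerBlDr yx xy.
Qed.

End RatPNorm.

(* Rational sequences that are Cauchy for |.|_p, a subring of nat -> rat, and
   the ideal of those which tend to 0. *)
Definition padic_cauchy (R : realType) (p : nat) : {pred nat -> rat} :=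
  fun u => `[< forall e : R, 0 < e -> exists N, forall m n,
    (N <= m)%N -> (N <= n)%N -> ratpnorm R p (u m - u n) < e >].

Section Cauchy.
Variables (R : realType) (p : nat).
Local Notation N := (ratpnorm R p).
Local Notation cauchy := (padic_cauchy R p).

Lemma padic_cauchyP u : reflect
  (forall e : R, 0 < e -> exists N0, forall m n,
     (N0 <= m)%N -> (N0 <= n)%N -> N (u m - u n) < e) (u \in cauchy).
Proof. exact: asboolP. Qed.

Lemma padic_cauchy_cvg u : u \in cauchy -> cvgn (N \o u : R^nat).
Proof.
move=> /padic_cauchyP cu; apply/cauchy_cvgP/cauchy_exP => e e0.
have [N0 h] := cu e e0; exists (N (u N0)).
exists N0 => // n /= hn; rewrite /ball /=.
exact: le_lt_trans (ratpnorm_distB _ _ _ _) (h _ _ (leqnn _) hn).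
Qed.

Lemma padic_cauchy_cst (x : rat) : (fun=> x) \in cauchy.
Proof.
by apply/padic_cauchyP => e e0; exists 0%N => m n _ _; rewrite subrr ratpnorm0.
Qed.

Lemma padic_cauchyB u v : u \in cauchy -> v \in cauchy -> u - v \in cauchy.
Proof.
move=> /padic_cauchyP cu /padic_cauchyP cv; apply/padic_cauchyP => e e0.
have [N1 h1] := cu e e0; have [N2 h2] := cv e e0.
exists (maxn N1 N2) => m n; rewrite !geq_max => /andP[m1 m2] /andP[n1 n2].
have -> : (u - v) m - (u - v) n = (u m - u n) - (v m - v n).
  rewrite -[(u - v) m]/(u m - v m) -[(u - v) n]/(u n - v n); ring.
apply: le_lt_trans (ratpnorm_ultra _ _ _ _) _.
by rewrite gt_max ratpnormN h1 // h2.
Qed.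

Lemma padic_cauchy_bounded u : u \in cauchy ->
  exists2 M : R, 0 < M & forall n, N (u n) <= M.
Proof.
move=> /padic_cauchyP /(_ 1 ltr01)[N0 h].
exists (1 + \sum_(i < N0.+1) N (u i)).
  by rewrite ltr_wpDr // sumr_ge0 // => i _; rewrite ratpnorm_ge0.
have le_sum (i : 'I_N0.+1) : N (u i) <= \sum_(i < N0.+1) N (u i).
  rewrite (bigD1 i) //= lerDl sumr_ge0 // => j _; exact: ratpnorm_ge0.
move=> n; case: (leqP N0 n) => hn.
  rewrite -[u n](subrK (u N0)) (le_trans (ratpnorm_triangle _ _ _ _)) //.
  by rewrite lerD // ?(ltW (h _ _ hn (leqnn _))) // (le_sum ord_max).
by rewrite (le_trans (le_sum (Ordinal (ltnW hn : (n < N0.+1)%N)))) // lerDr.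
Qed.

Lemma padic_cauchyM u v : u \in cauchy -> v \in cauchy -> u * v \in cauchy.
Proof.
move=> cu cv; have [A A0 hA] := padic_cauchy_bounded cu.
have [B B0 hB] := padic_cauchy_bounded cv.
move: cu cv => /padic_cauchyP cu /padic_cauchyP cv; apply/padic_cauchyP => e e0.
have [N1 h1] := cu _ (divr_gt0 e0 B0); have [N2 h2] := cv _ (divr_gt0 e0 A0).
exists (maxn N1 N2) => m n; rewrite !geq_max => /andP[m1 m2] /andP[n1 n2].
have -> : (u * v) m - (u * v) n = (u m - u n) * v m + u n * (v m - v n).
  rewrite -[(u * v) m]/(u m * v m) -[(u * v) n]/(u n * v n); ring.
apply: le_lt_trans (ratpnorm_ultra _ _ _ _) _; rewrite gt_max !ratpnormM.
have := h1 m n m1 n1; rewrite ltr_pdivlMr // => k1.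
have := h2 m n m2 n2; rewrite ltr_pdivlMr // mulrC => k2.
by rewrite (le_lt_trans _ k1) ?(le_lt_trans _ k2) // ?ler_wpM2l ?ler_wpM2r
  ?ratpnorm_ge0.
Qed.

Fact padic_cauchy_subring : subring_closed cauchy.
Proof.
split; first exact: (padic_cauchy_cst 1).
  exact: padic_cauchyB.
exact: padic_cauchyM.
Qed.
HB.instance Definition _ :=
  GRing.isSubringClosed.Build (nat -> rat) cauchy padic_cauchy_subring.
End Cauchy.

Record padic_seq (R : realType) (p : nat) := PadicSeq {
  padic_seq_val :> nat -> rat;
  padic_seqP : padic_seq_val \in padic_cauchy R p }.

HB.instance Definition _ R p := [isSub for @padic_seq_val R p].
HB.instance Definition _ R p := [Choice of padic_seq R p by <:].
HB.instance Definition _ R p :=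
  [SubChoice_isSubComNzRing of padic_seq R p by <:].

Definition padic_null (R : realType) (p : nat) : {pred padic_seq R p} :=
  fun u => `[< ratpnorm R p (u n) @[n --> \oo] --> (0 : R) >].

Section Null.
Variables (R : realType) (p : nat).
Local Notation N := (ratpnorm R p).
Implicit Types u v a : padic_seq R p.

Lemma padic_nullP u : reflect
  (forall e : R, 0 < e -> exists N0, forall n, (N0 <= n)%N -> N (u n) < e)
  (u \in @padic_null R p).
Proof.
apply: (iffP (asboolP _)) => [/cvgr0Pnorm_lt h e /h[N0 _ hN]|h].
  by exists N0 => n /hN /=; rewrite ger0_norm ?ratpnorm_ge0.
apply/cvgr0Pnorm_lt => e /h[N0 hN]; exists N0 => // n /hN /=.
by rewrite ger0_norm ?ratpnorm_ge0.
Qed.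

Fact padic_null_idealr : idealr_closed (@padic_null R p).
Proof.
split.
- by apply/padic_nullP => e e0; exists 0%N => n _; rewrite ratpnorm0.
- apply/negP => /padic_nullP /(_ 1 ltr01)[N0 /(_ _ (leqnn _))].
  by rewrite ratpnorm1 ltxx.
move=> a u v /padic_nullP hu /padic_nullP hv; apply/padic_nullP => e e0.
have [M M0 hM] := padic_cauchy_bounded (padic_seqP a).
have [N1 h1] := hu _ (divr_gt0 e0 M0); have [N2 h2] := hv _ e0.
exists (maxn N1 N2) => n; rewrite geq_max => /andP[/h1 k1 /h2 k2].
rewrite -[(a * u + v) n]/(a n * u n + v n).
apply: le_lt_trans (ratpnorm_ultra _ _ _ _) _; rewrite gt_max k2 andbT.
rewrite ratpnormM; move: k1; rewrite ltr_pdivlMr // mulrC; apply: le_lt_trans.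
by rewrite ler_wpM2r ?ratpnorm_ge0.
Qed.
HB.instance Definition _ :=
  isIdealr.Build (padic_seq R p) (@padic_null R p) padic_null_idealr.
End Null.

(* The field Q_p, as the completion of rat for |.|_p. *)
Definition padic (R : realType) (p : nat) := {ideal_quot (@padic_null R p)}.
HB.instance Definition _ R p := GRing.ComNzRing.on (padic R p).

Definition padic_norm (R : realType) (p : nat) (x : padic R p) : R :=
  limn (fun n => ratpnorm R p (repr x n)).

Section Padic.
Variables (R : realType) (p : nat).
Local Notation N := (ratpnorm R p).
Local Notation Qp := (padic R p).
Implicit Types (u v : padic_seq R p) (x y : Qp).

Lemma padic_pi_eq u v : (\pi_Qp u == \pi_Qp v) = (u - v \in @padic_null R p).
Proof. by rewrite Quotient.idealrBE. Qed.

Lemma padic_piB u v : \pi_Qp (u - v) = \pi_Qp u - \pi_Qp v :> Qp.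
Proof. exact: raddfB. Qed.

Lemma padic_piM u v : \pi_Qp (u * v) = \pi_Qp u * \pi_Qp v :> Qp.
Proof. exact: rmorphM. Qed.

Lemma padic_seq_cvg u : cvgn (fun n => N (u n)).
Proof. exact: padic_cauchy_cvg (padic_seqP u). Qed.

Lemma padic_normE u : padic_norm (\pi_Qp u) = limn (fun n => N (u n)).
Proof.
rewrite /padic_norm; set r := repr _.
have /asboolP h : r - u \in @padic_null R p by rewrite -padic_pi_eq reprK.
apply/eqP; rewrite -subr_eq0 -limB; try exact: padic_seq_cvg.
apply/eqP/cvg_lim => //; apply/cvgr0Pnorm_lt => e e0.
move/cvgr0Pnorm_lt : h => /(_ e e0); apply: filterS => n.
rewrite ger0_norm ?ratpnorm_ge0 //; apply: le_lt_trans.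
exact: ratpnorm_distB.
Qed.

Lemma padic_norm_ge0 x : 0 <= padic_norm x.
Proof.
apply: limr_ge; first exact: padic_seq_cvg.
by apply: nearW => n; exact: ratpnorm_ge0.
Qed.

Lemma padic_norm_eq0 x : padic_norm x = 0 -> x = 0.
Proof.
move=> x0; rewrite -[x]reprK -[0]reprK; apply/eqP; rewrite padic_pi_eq.
have -> : repr x - repr (0 : Qp) = repr x * 1 - repr (0 : Qp) by rewrite mulr1.
rewrite rpredB // ?mulr1; last first.
  by rewrite -[repr _]subr0 -padic_pi_eq reprK raddf0.
by apply/asboolP; have := @padic_seq_cvg (repr x); rewrite -/(padic_norm x) x0.
Qed.

Lemma padic_norm0 : padic_norm (0 : Qp) = 0.
Proof.
rewrite -(raddf0 \pi_Qp) padic_normE; under eq_fun do rewrite ratpnorm0.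
exact: lim_cst.
Qed.

Lemma padic_norm1 : padic_norm (1 : Qp) = 1.
Proof.
rewrite -(rmorph1 \pi_Qp) padic_normE; under eq_fun do rewrite ratpnorm1.
exact: lim_cst.
Qed.

Lemma padic_normM x y : padic_norm (x * y) = padic_norm x * padic_norm y.
Proof.
rewrite -[x]reprK -[y]reprK -padic_piM !padic_normE.
rewrite -limM; try exact: padic_seq_cvg.
by congr (limn _); apply/funext => n; exact: ratpnormM.
Qed.

Lemma padic_normN x : padic_norm (- x) = padic_norm x.
Proof.
rewrite -[x]reprK -raddfN !padic_normE.
by congr (limn _); apply/funext => n; exact: ratpnormN.
Qed.

Lemma padic_norm_triangle x y :
  padic_norm (x + y) <= padic_norm x + padic_norm y.
Proof.
rewrite -[x]reprK -[y]reprK -raddfD !padic_normE.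
rewrite -limD; try exact: padic_seq_cvg.
apply: ler_lim; try apply: is_cvgD; try exact: padic_seq_cvg.
by apply: nearW => n; exact: ratpnorm_triangle.
Qed.

Let dist x y := padic_norm (x - y).

Let distxx x : dist x x = 0. Proof. by rewrite /dist subrr padic_norm0. Qed.

Let dist_eq0 x y : dist x y = 0 -> x = y.
Proof. by move/padic_norm_eq0/eqP; rewrite subr_eq0 => /eqP. Qed.

Let distC x y : dist x y = dist y x.
Proof. by rewrite /dist -padic_normN opprB. Qed.

Let dist_triangle y x z : dist x z <= dist x y + dist y z.
Proof.
by apply: le_trans (padic_norm_triangle _ _); rewrite addrA subrK.
Qed.

HB.instance Definition _ := isPointed.Build Qp 0.
HB.instance Definition _ :=
  isMetric.Build R Qp distxx dist_eq0 distC dist_triangle.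

Lemma padic_has_inv x : x != 0 -> exists y, y * x = 1.
Proof.
rewrite -[x]reprK; set u := repr x; move=> u0.
have [e e0 he] : exists2 e : R, 0 < e &
    forall N0, exists2 n, (N0 <= n)%N & e <= N (u n).
  apply: contrapT => /forall2NP h.
  have : u \in @padic_null R p.
    apply/padic_nullP => e e0; apply: contrapT => h'.
    case: (h e) => // {}h; apply: h => N0; apply: contrapT => /forall2NP k.
    apply: h'; exists N0 => n hn; case: (k n) => // /negP.
    by rewrite -ltNge.
  rewrite -[u]subr0 -padic_pi_eq raddf0; exact/negP.
have /padic_cauchyP cu := padic_seqP u; have [N0 hN] := cu e e0.
have lb m : (N0 <= m)%N -> e <= N (u m).
  have [n0 hn0 en0] := he N0; move=> hm; rewrite leNgt; apply/negP => lt.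
  have := ratpnorm_ultra R p (u m) (u n0 - u m).
  rewrite addrC subrK leNgt gt_max (lt_le_trans lt) //.
  by rewrite (lt_le_trans (hN _ _ hn0 hm)).
have nz m : (N0 <= m)%N -> u m != 0.
  by move=> /lb hm; rewrite -(ratpnorm_eq0 R p) gt_eqF // (lt_le_trans e0).
have cv : (fun n => (u n)^-1) \in padic_cauchy R p.
  apply/padic_cauchyP => d d0; have [N1 h1] := cu _ (mulr_gt0 d0 (mulr_gt0 e0 e0)).
  exists (maxn N0 N1) => m n; rewrite !geq_max => /andP[m1 m2] /andP[n1 n2].
  have -> : (u m)^-1 - (u n)^-1 = (u n - u m) / (u m * u n).
    by field; rewrite !nz.
  rewrite ratpnormM ratpnormV ratpnormM.
  have pm : 0 < N (u m) by rewrite (lt_le_trans e0) ?lb.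
  have pn : 0 < N (u n) by rewrite (lt_le_trans e0) ?lb.
  rewrite ltr_pdivrMr ?mulr_gt0 //; apply: lt_le_trans (h1 _ _ n2 m2) _.
  by rewrite ler_pM2l // ler_pM ?lb // ltW.
exists (\pi_Qp (PadicSeq cv)); rewrite -padic_piM -(rmorph1 \pi_Qp).
apply/eqP; rewrite padic_pi_eq; apply/padic_nullP => d d0.
exists N0 => n hn; set w := (X in X n).
by rewrite -[w n]/((u n)^-1 * u n - 1) mulVf ?nz // subrr ratpnorm0.
Qed.

Definition padic_inv x : Qp := xget 0 [set y | y * x = 1].

Fact padic_mulVf x : x != 0 -> padic_inv x * x = 1.
Proof. by move=> /padic_has_inv hx; exact: (xgetPex 0 hx). Qed.

Fact padic_inv0 : padic_inv 0 = 0.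
Proof.
by apply: xgetPN => y /=; rewrite mulr0 => /eqP; rewrite eq_sym oner_eq0.
Qed.

HB.instance Definition _ :=
  GRing.ComNzRing_isField.Build Qp padic_mulVf padic_inv0.

End Padic.

Section PadicLimits.
Variables (R : realType) (p : nat).
Local Notation N := (ratpnorm R p).
Local Notation Qp := (padic R p).

Lemma padic_intE (a : int) : a%:~R =
  \pi_Qp (PadicSeq (padic_cauchy_cst R p a%:~R)).
Proof.
rewrite -(rmorph_int \pi_Qp); congr (\pi_Qp _); apply: val_inj => /=.
have nE k : padic_seq_val (k%:R : padic_seq R p) = fun=> k%:R.
  elim: k => // k ih; rewrite mulrS; apply/funext => n.
  by rewrite -[LHS]/(1 + padic_seq_val k%:R n) ih mulrS.
case: a => k; first by rewrite -!pmulrn; exact: nE.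
rewrite NegzE !rmorphN /= -!pmulrn; apply/funext => n.
by rewrite -[LHS]/(- padic_seq_val k.+1%:R n) nE.
Qed.

Lemma padic_norm_int (a : int) : padic_norm (a%:~R : Qp) = N a%:~R.
Proof. rewrite padic_intE padic_normE. apply: lim_cst; [exact: Rhausdorff | exact: eventually_filter]. Qed.

Lemma padic_int_cvg (a : nat -> int)
  (ca : (fun n => (a n)%:~R) \in padic_cauchy R p) :
  (a n)%:~R @[n --> \oo] --> (\pi_Qp (PadicSeq ca) : Qp).
Proof.
apply/metricType_numDomainType.cvgrPdist_lt => e e0.
have /padic_cauchyP /(_ _ (divr_gt0 e0 (ltr0n R 2)))[N0 h] := ca.
exists N0 => // n /= hn.
rewrite /mdist /= padic_intE -padic_piB padic_normE.
apply: (@le_lt_trans _ _ (e / 2)); last by rewrite gtr_pMr // invf_lt1 // ltr1n.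
apply: limr_le; first exact: padic_seq_cvg.
by exists N0 => // m /= hm; rewrite ltW // h.
Qed.
End PadicLimits.

Fixpoint thue_morse_rec (k n : nat) : int :=
  if k isn't k'.+1 then 1 else
  if odd n then - thue_morse_rec k' n./2 else thue_morse_rec k' n./2.

(* n steps of halving are enough to reach the initial value. *)
Definition thue_morse (n : nat) : int := thue_morse_rec n n.

Lemma thue_morse_recE k n : (n <= k)%N -> thue_morse_rec k n = thue_morse n.
Proof.
rewrite /thue_morse; elim/ltn_ind: n k => n ih k.
case: n ih => [|n] ih; first by move=> _; elim: k.
case: k => // k; rewrite ltnS => nk /=.
have lt : (uphalf n <= n)%N by rewrite uphalf_half -{3}(odd_double_half n) -addnn; lia.
by rewrite !(ih _ (_ : uphalf n < n.+1)%N) // (leq_trans lt).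
Qed.

Lemma thue_morse0 : thue_morse 0 = 1. Proof. by []. Qed.

Lemma thue_morse_double n : thue_morse n.*2 = thue_morse n.
Proof.
case: n => // n; have -> : thue_morse n.+1.*2 =
    if odd n.+1.*2 then - thue_morse_rec n.*2.+1 n.+1.*2./2
    else thue_morse_rec n.*2.+1 n.+1.*2./2 by [].
by rewrite odd_double doubleK thue_morse_recE // ltnS -addnn leq_addr.
Qed.

Lemma thue_morse_doubleS n : thue_morse n.*2.+1 = - thue_morse n.
Proof.
by rewrite {1}/thue_morse /= odd_double /= uphalf_double thue_morse_recE // -addnn leq_addr.
Qed.

Definition thue_morse_padic (R : realType) (p : nat) : padic R p :=
  limn (series (fun n => (thue_morse n)%:~R * p%:R ^+ n) : nat -> padic R p).

Lemma thue_morse_padic_cvg (R : realType) (p : nat) : prime p ->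
  (series (fun n => (thue_morse n)%:~R * p%:R ^+ n) : nat -> padic R p) @ \oo
  --> thue_morse_padic R p.
Proof.
move=> pr; pose a n : int := \sum_(0 <= k < n) thue_morse k * p%:R ^+ k.
have p0 : 0 < p%:R :> R by rewrite ltr0n prime_gt0.
have np (k : nat) : ratpnorm R p (p%:R ^+ k) = p%:R ^- k.
  rewrite -natrX -[_%:R]/((p ^ k)%N%:~R) /ratpnorm intr_eq0 /padicval.
  rewrite numq_int denq_int /= logn1 subr0 pfactorK // -exprnN ifF //.
  by apply/negbTE; rewrite -lt0n expn_gt0 prime_gt0.
have ca : (fun n => (a n)%:~R) \in padic_cauchy R p.
  apply/padic_cauchyP => e e0.
  have [N0 hN] : exists N0, (p%:R : R) ^- N0 < e.
    have lt1 : `|(p%:R : R)^-1| < 1.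
      by rewrite gtr0_norm ?invr_gt0 // invf_lt1 // ltr1n prime_gt1.
    have /cvgr0Pnorm_lt /(_ _ e0)[N0 _ h] := cvg_expr lt1.
    exists N0; have := h N0 (leqnn _); rewrite /= exprVn gtr0_norm //.
    by rewrite invr_gt0 exprn_gt0.
  exists N0 => m n; wlog nm : m n / (n <= m)%N.
    move=> h hm hn; case/orP: (leq_total n m) => nm; first exact: h.
    by rewrite -ratpnormN opprB h.
  move=> hm hn; apply: le_lt_trans hN.
  have -> : (a m)%:~R - (a n)%:~R = p%:R ^+ N0 *
      (\sum_(n <= k < m) thue_morse k * p%:R ^+ (k - N0))%:~R :> rat.
    rewrite -rmorphB /a (big_cat_nat (leq0n n) nm) /=. rewrite addrAC subrr add0r.
    have -> : p%:R ^+ N0 = (p%:R ^+ N0)%:~R :> rat by rewrite rmorphXn rmorph_nat.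
    rewrite -rmorphM /= mulr_sumr; congr (_%:~R).
    apply: eq_big_nat => k /andP[nk _].
    by rewrite mulrCA -exprD subnKC // (leq_trans hn).
  by rewrite ratpnormM np ler_piMr ?ratpnorm_int_le1 // invr_ge0 exprn_ge0 // ltW.
rewrite /thue_morse_padic.
have -> : series (fun n => (thue_morse n)%:~R * p%:R ^+ n) =
    (fun n => (a n)%:~R) :> (nat -> padic R p).
  apply/funext => n; rewrite /series /= /a rmorph_sum; apply: eq_bigr => k _.
  by rewrite rmorphM rmorphXn rmorph_nat.
by apply/cvg_ex; exists (\pi_(padic R p) (PadicSeq ca) : padic R p); exact: padic_int_cvg.
Qed.

Definition sqrt_absM (R : realType) (a b : int) : R :=
  Num.sqrt `|(a * b)%:~R|.

Definition mult_irrationality_exponent (R : realType) (p : nat)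
    (xi : padic R p) : \bar R :=
  ereal_sup [set mu%:E | mu in [set mu : R |
    infinite_set [set ab : int * int | [/\ ab.1 != 0, ab.2 != 0,
      0 < padic_norm (ab.2%:~R * xi - ab.1%:~R) &
      padic_norm (ab.2%:~R * xi - ab.1%:~R)
        <= sqrt_absM R ab.1 ab.2 `^ (- mu)]]]].

Definition uniform_mult_irrationality_exponent (R : realType) (p : nat)
    (xi : padic R p) : \bar R :=
  ereal_sup [set mu%:E | mu in [set mu : R |
    exists X0 : R, forall X : R, X0 <= X -> exists a b : int,
      [/\ 0 < sqrt_absM R a b, sqrt_absM R a b <= X &
        padic_norm (b%:~R * xi - a%:~R) <= X `^ (- mu)]]].

(* Main.v *)
Require Import Defs.
From mathcomp Require Import all_boot all_order all_algebra.
From mathcomp Require Import all_classical all_reals all_analysis.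
From mathcomp Require Import ring lra zify.
Set Implicit Arguments.
Unset Strict Implicit.
Unset Printing Implicit Defensive.
Import Order.TTheory GRing.Theory Num.Theory.
Import numFieldNormedType.Exports.
Local Open Scope classical_set_scope.
Local Open Scope ring_scope.

(* Write P_k(w) for the product of the 1 - w^(2^j), j < k, and q = p^(2^k), so
   that xi is congruent to P_k(p) P_l(q) modulo q^(2^l).  A Pade approximant
   B P_l = A modulo w^M thus gives integers a = P_k(p) A(q), b = B(q) with
   |b xi - a| <= q^(-M).  For B = 1 + w, A = 1 - 2 w^2 one has M = 6 while |ab|
   is of order q^4, whence the exponent 3.

   Conversely, if a s <> b r and |as| + |br| < q^M then |s xi - r| is at least
   1 / (|as| + |br|).  When |s| <= |r| the approximants above suffice for a
   suitable k; if (r, s) is proportional to (a, b) one uses that gcd(a, b)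
   divides 2 and that the error of (a, b) is known exactly.  When |r| < |s| one
   compares (r, s) with two non proportional approximants of the same quality,
   taken from a finite list according to the sizes of r and s.

   For the uniform exponent one needs, for N = 2^l, that all the Pade
   approximants of P_l on the antidiagonal of order N are normal.  Modulo 4,
   after the substitution w = (z^2 + z) / (z^2 + z + 1), the product P_l becomes
   1 + 2 (z + z^(N/2)), and normality reduces to a statement on polynomials over
   the field with two elements, which follows from the symmetry z -> z + 1 and
   the identity (z^2 + z + 1)^N = z^(2N) + z^N + 1. *)

(** * The Thue-Morse products modulo 4 *)

Lemma poly_expand (R : nzRingType) d (p : {poly R}) : (size p <= d)%N ->
  p = \sum_(i < d) p`_i *: 'X^i.
Proof.
move=> sp; apply/polyP => i; rewrite -poly_def coef_poly; case: ltnP => // h.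
by rewrite nth_default // (leq_trans sp).
Qed.

Section Homogenization.
Variables (R : comNzRingType) (x y : {poly R}).
Implicit Types (p q : {poly R}) (d : nat).

(** This is y^d p(x/y) without denominators, i.e. the substitution w = x/y; it is used below with x
    = z^2 + z and y = x + 1. *)
Definition homog d p : {poly R} :=
  \sum_(i < d.+1) p`_i *: (x ^+ i * y ^+ (d - i)).

Lemma homogD d p q : homog d (p + q) = homog d p + homog d q.
Proof.
by rewrite -big_split; apply: eq_bigr => i _; rewrite coefD scalerDl.
Qed.

Lemma homogZ d c p : homog d (c *: p) = c *: homog d p.
Proof.
by rewrite scaler_sumr; apply: eq_bigr => i _; rewrite coefZ scalerA.
Qed.

Lemma homog0 d : homog d 0 = 0.
Proof. by rewrite -[X in homog d X](scale0r 0) homogZ scale0r. Qed.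

Lemma homog_sum d (I : Type) (r : seq I) (f : I -> {poly R}) :
  homog d (\sum_(i <- r) f i) = \sum_(i <- r) homog d (f i).
Proof. exact: (big_morph (homog d) (homogD d) (homog0 d)). Qed.

Lemma homogXn d i : (i <= d)%N -> homog d 'X^i = x ^+ i * y ^+ (d - i).
Proof.
rewrite -ltnS => id; rewrite /homog (bigD1 (Ordinal id)) //= coefXn eqxx scale1r.
rewrite big1 ?addr0 // => j /eqP ji; rewrite coefXn; case: eqP => [e|]; last by rewrite scale0r.
by case: ji; apply: val_inj.
Qed.

Lemma homogM d1 d2 p q : (size p <= d1.+1)%N -> (size q <= d2.+1)%N ->
  homog (d1 + d2) (p * q) = homog d1 p * homog d2 q.
Proof.
move=> sp sq; rewrite [in LHS](poly_expand sp) [in LHS](poly_expand sq) mulr_suml homog_sum.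
rewrite mulr_suml; apply: eq_bigr => i _; rewrite mulr_sumr homog_sum mulr_sumr.
apply: eq_bigr => j _; rewrite -scalerAl -scalerAr -exprD !homogZ homogXn; last first.
  by have := ltn_ord i; have := ltn_ord j; lia.
have -> : (d1 + d2 - (i + j) = (d1 - i) + (d2 - j))%N.
  by have := ltn_ord i; have := ltn_ord j; lia.
rewrite -!scalerAl -!scalerAr; congr (_ *: (_ *: _)); rewrite !exprD; ring.
Qed.

Lemma homog_lead d1 d2 p : (size p <= d1.+1)%N ->
  homog (d1 + d2) p = homog d1 p * y ^+ d2.
Proof.
move=> sp; rewrite -[p in LHS]mulr1 homogM ?size_poly1 //; congr (_ * _).
by rewrite -[1]/('X^0) homogXn // expr0 mul1r subn0.
Qed.

Lemma homog_comp d p g : x \Po g = x -> y \Po g = y ->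
  homog d p \Po g = homog d p.
Proof.
move=> xg yg; rewrite /homog linear_sum; apply: eq_bigr => i _.
by rewrite linearZ /= rmorphM !rmorphXn /= xg yg.
Qed.

Lemma size_exp_le2 (f : {poly R}) i : (size f <= 3)%N ->
  (size (f ^+ i) <= i.*2.+1)%N.
Proof.
move=> sf; apply: leq_trans (size_poly_exp_leq _ _) _.
by rewrite ltnS -mul2n leq_mul2r; apply/orP; right; lia.
Qed.

Lemma size_homog d p : (size x <= 3)%N -> (size y <= 3)%N ->
  (size (homog d p) <= d.*2.+1)%N.
Proof.
move=> sx sy; apply: (leq_trans (size_sum _ _ _)); apply/bigmax_leqP => i _.
apply: leq_trans (size_scale_leq _ _) _; apply: leq_trans (size_polyMleq _ _) _.
have := size_exp_le2 i sx; have := size_exp_le2 (d - i) sy.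
by have := ltn_ord i; rewrite -!addnn; lia.
Qed.

End Homogenization.

(** If i is the least index of a nonzero coefficient, the form is x^i times a polynomial whose value
    at 0 is that coefficient. *)
Lemma homog_eq0 (R : idomainType) (x y : {poly R}) d (p : {poly R}) :
  x != 0 -> x.[0] = 0 -> y.[0] = 1 -> (size p <= d.+1)%N ->
  homog x y d p = 0 -> p = 0.
Proof.
move=> x0 xz y1 sp h; apply/eqP; apply: contraT => pn0.
have ex : exists i, p`_i != 0 by exists (size p).-1; rewrite -/(lead_coef p) lead_coef_eq0.
case: (ex_minnP ex) => i pi mini.
have id : (i < d.+1)%N.
  by apply: leq_trans sp; rewrite ltnNge; apply: contra pi => /(nth_default 0) ->.
have : homog x y d p = x ^+ i * \sum_(j < d.+1 | (i <= j)%N) p`_j *: (x ^+ (j - i) * y ^+ (d - j)).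
  rewrite mulr_sumr /homog [RHS]big_mkcond; apply: eq_bigr => j _.
  case: leqP => ij.
    by rewrite -scalerAr mulrA -exprD subnKC.
  have [->|pj] := eqVneq p`_j 0; first by rewrite scale0r.
  by move: ij; rewrite ltnNge mini.
rewrite h => /esym/eqP; rewrite mulf_eq0 expf_eq0 (negbTE x0) andbF /= => /eqP.
move/(congr1 (horner^~ 0)); rewrite horner0 horner_sum (bigD1 (Ordinal id)) //=.
rewrite subnn mul1r hornerZ horner_exp y1 expr1n mulr1 big1 ?addr0 => [e|j /andP[ij /eqP ne]].
  by rewrite e eqxx in pi.
rewrite hornerZ hornerM horner_exp xz expr0n subn_eq0 leqNgt ltn_neqAle ij andbT.
case: eqP => [e|_]; first by case: ne; apply: val_inj.
by rewrite mul0r mulr0.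
Qed.

(** The shift keeps the degree and the leading coefficient c, so the top coefficient of the form is
    c^2 - c^2 + c^2 = c^2. *)
Lemma shift_form_eq0 (F : idomainType) (G : {poly F}) :
  let H := G \Po ('X + 1) in G ^+ 2 - G * H + H ^+ 2 = 0 -> G = 0.
Proof.
move=> H h; apply/eqP; rewrite -lead_coef_eq0; have s2 := size_XaddC (1 : F).
have sH : size H = size G by exact: size_comp_poly2.
have lH : lead_coef H = lead_coef G.
  rewrite lead_coef_comp ?lead_coefXaddC ?expr1n ?mulr1 //.
  by rewrite [X in (_ < X)%N]s2.
have := congr1 (fun p : {poly F} => p`_(size G + size G).-2) h.
have cM (p q : {poly F}) : size p = size G -> size q = size G ->
    (p * q)`_(size G + size G).-2 = lead_coef p * lead_coef q.
  by move=> sp sq; rewrite mul_lead_coef sp sq.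
rewrite coefD coefB coef0 !expr2 !cM // lH subrr add0r => /eqP.
by rewrite mulf_eq0 orbb.
Qed.

Section CharTwo.
Variables (F : fieldType) (F2 : 2%N \in [pchar F]).
Local Notation X := ('X^2 + 'X : {poly F}).
Local Notation Z := ('X^2 + 'X + 1 : {poly F}).

Lemma exprDn_char2 (u v : {poly F}) l :
  (u + v) ^+ (2 ^ l) = u ^+ (2 ^ l) + v ^+ (2 ^ l).
Proof.
apply: exprDn_pchar; rewrite pnatX; apply/orP; left.
by rewrite pnatE // pchar_poly.
Qed.

Lemma size_Z : size Z = 3%N.
Proof. by rewrite -addrA size_polyDl size_polyXn // size_XaddC. Qed.

(* The substitution z -> z + 1 exchanges the two branches z of z^2 + z = X. *)
Lemma char2_nonsingular l a e (A E : {poly F}) :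
  (a + e = 2 ^ l)%N -> (a < e)%N -> (size A <= a)%N -> (size E <= e)%N ->
  (exists K, homog X Z e.-1 E + 'X * homog X Z e.-2 A = 'X^(2 ^ l) * K) ->
  A = 0.
Proof.
set N := (2 ^ l)%N => aeN ae sA sE [G WG].
have [a0|a0] := posnP a; first by apply/eqP; rewrite -size_poly_eq0 -leqn0 -a0.
have p2 (p : {poly F}) : p *+ 2 = 0.
  by rewrite -mulr_natr; move: F2; rewrite -pchar_poly => /pcharf0 ->; rewrite mulr0.
pose g : {poly F} := 'X + 1; pose H := G \Po g.
have Xg : X \Po g = X.
  rewrite rmorphD rmorphXn /= comp_polyX /g.
  have -> : ('X + 1) ^+ 2 + ('X + 1) = 'X^2 + 'X + ('X + 1) *+ 2 :> {poly F} by ring.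
  by rewrite p2 addr0.
have Zg : Z \Po g = Z by rewrite rmorphD /= Xg rmorph1.
set hA := homog X Z e.-2 A in WG.
have sX : (size X <= 3)%N.
  by rewrite (leq_trans (size_polyD _ _)) // geq_max size_polyXn size_polyX.
have sZ := size_Z; have sZ' : (size Z <= 3)%N by rewrite sZ.
have sG : (size G <= e - a.+1)%N.
  have [->|G0] := eqVneq G 0; first by rewrite size_poly0.
  have : (size ('X^N * G)%R <= e.-1.*2.+1)%N.
    rewrite -WG (leq_trans (size_polyD _ _)) // geq_max size_homog //=.
    rewrite (leq_trans (size_polyMleq _ _)) // size_polyX.
    have := size_homog e.-2 A sX sZ'; rewrite -/hA; set k := size _; clearbody k. move: a0 ae; clear; move=> a0 ae h. lia.
  by rewrite mulrC size_mulXn // -addnn; lia.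
have hAe : hA = homog X Z a.-1 A * Z ^+ (e - a.+1).
  by rewrite -homog_lead ?prednK //; congr homog; lia.
have tgE : ('X + 1) ^+ N = 'X^N + 1 :> {poly F} by rewrite exprDn_char2 expr1n.
have ZN : Z ^+ N = 'X^N ^+ 2 + 'X^N + 1.
  by rewrite !exprDn_char2 expr1n -!exprM mulnC.
(* Both homogenized polynomials are fixed by z -> z + 1, so subtracting the relation from its
   shifted copy isolates [hA]. *)
have rel : ('X^N + 1) * H - 'X^N * G = hA.
  rewrite -WG -[in X in X * H]tgE.
  have -> : ('X + 1) ^+ N * H = ('X^N * G) \Po g by rewrite rmorphM rmorphXn /= comp_polyX.
  rewrite -WG rmorphD rmorphM /= comp_polyX !homog_comp // /g -/hA; ring.
have G0 : G = 0.
  apply: shift_form_eq0; rewrite -/g -/H; apply/eqP; apply: contraT => Q0.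
  (* With t = z^N, [rel] gives H = (t + 1) G modulo Z^(e-a-1), and 1 - (t + 1) + (t + 1)^2 = Z^N. By
     [sG] the form has degree less than that of Z^(e-a-1), so it vanishes. *)
  have : (Z ^+ (e - a.+1) %| G ^+ 2 - G * H + H ^+ 2).
    have -> : G ^+ 2 - G * H + H ^+ 2 =
        Z ^+ N * G ^+ 2 + (Z ^+ N * (H - G) - 'X^N * hA) *
        (('X^N + 1) * G *+ 2 - G + (Z ^+ N * (H - G) - 'X^N * hA)).
      by rewrite ZN -rel; ring.
    have zN : Z ^+ (e - a.+1) %| Z ^+ N by apply: dvdp_exp2l; lia.
    have zA : Z ^+ (e - a.+1) %| hA by rewrite hAe dvdp_mull.
    apply: dvdp_add; first exact: dvdp_mulr.
    by apply: dvdp_mulr; apply: dvdp_sub; [exact: dvdp_mulr | exact: dvdp_mull].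
  move/(dvdp_leq Q0).
  have Zn0 : Z != 0 by rewrite -size_poly_eq0 sZ.
  have -> : size (Z ^+ (e - a.+1)) = (e - a.+1).*2.+1.
    by rewrite polySpred ?expf_neq0 // size_exp sZ mul2n.
  have sH : size H = size G by apply: size_comp_poly2; exact: size_XaddC.
  have : (size (G ^+ 2 - G * H + H ^+ 2)%R <= (size G).*2.-1)%N.
    have sM (p q : {poly F}) : size p = size G -> size q = size G ->
        (size (p * q)%R <= (size G).*2.-1)%N.
      by move=> sp sq; rewrite (leq_trans (size_polyMleq _ _)) // sp sq addnn.
    apply: leq_trans (size_polyD _ _) _; rewrite geq_max sM // andbT.
    by apply: leq_trans (size_polyD _ _) _; rewrite geq_max size_polyN !sM.
  move=> le1 le2; have := leq_trans le2 le1.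
  have : (0 < size (G ^+ 2 - G * H + H ^+ 2)%R)%N by rewrite size_poly_gt0.
  by move: sG le1; rewrite -!addnn; move: (size G) (size _) => u v; lia.
have hA0 : hA = 0 by rewrite -rel /H G0 comp_poly0 !mulr0 subrr.
apply: (@homog_eq0 _ X Z e.-2) => //.
- by rewrite -size_poly_eq0 size_polyDl ?size_polyXn ?size_polyX.
- by rewrite !(hornerE, hornerXn) ?expr0n ?mul0r ?addr0.
- by rewrite !(hornerE, hornerXn) ?expr0n ?mul0r ?addr0 ?add0r.
- by apply: leq_trans sA _; move: a0 ae; clear; lia.
Qed.
End CharTwo.

Lemma size_polyM_le (R : nzRingType) (p q : {poly R}) i j :
  (size p <= i)%N -> (size q <= j)%N -> (size (p * q)%R <= (i + j).-1)%N.
Proof. by move=> pi qj; rewrite (leq_trans (size_polyMleq _ _)) //; lia. Qed.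

Lemma size_oneBXn (R : nzRingType) m : (size (1 - 'X^m : {poly R})%R <= m.+1)%N.
Proof.
by rewrite (leq_trans (size_polyD _ _)) // geq_max size_poly1 size_polyN size_polyXn leqnn.
Qed.

Lemma homog_oneBXn (R : comNzRingType) (x y : {poly R}) m :
  homog x y m (1 - 'X^m) = y ^+ m - x ^+ m.
Proof.
rewrite homogD -scaleN1r homogZ -(expr0 'X) !homogXn // scaleN1r.
by rewrite subnn subn0 !expr0 mul1r mulr1.
Qed.

Definition tm_poly l : {poly int} := \prod_(j < l) (1 - 'X^(2 ^ j)).

Lemma tm_polyS l : tm_poly l.+1 = tm_poly l * (1 - 'X^(2 ^ l)).
Proof. by rewrite /tm_poly big_ord_recr. Qed.

Lemma size_tm_poly l : (size (tm_poly l) <= 2 ^ l)%N.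
Proof.
elim: l => [|l ih]; first by rewrite /tm_poly big_ord0 size_poly1.
rewrite tm_polyS (leq_trans (size_polyM_le ih (size_oneBXn _ _))) //.
by rewrite expnS; lia.
Qed.

Local Notation mod2 := (map_poly (intmul (1 : 'F_2))).

Lemma mod2_eq0 (p : {poly int}) : mod2 p = 0 -> exists q, p = q *+ 2.
Proof.
move=> p0; exists (map_poly (fun c => (c %/ 2)%Z) p); apply/polyP => i.
have : ((p`_i)%:~R : 'F_2) == 0 by rewrite -coef_map p0 coef0.
rewrite -(dvdz_pcharf (pchar_Fp (isT : prime 2))) => /divzK e.
by rewrite coefMn coef_map_id0 // -[RHS]mulr_natr e.
Qed.

Lemma mod2_double (p : {poly int}) : mod2 (p *+ 2) = 0.
Proof.
have two0 : (2%:R : {poly 'F_2}) = 0.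
  by apply: (@pcharf0 _ 2); rewrite pchar_poly pchar_Fp.
by rewrite rmorphMn -mulr_natr /= two0 mulr0.
Qed.

Lemma map_homog (R S : comNzRingType) (f : {rmorphism R -> S}) (x y : {poly R}) d p :
  map_poly f (homog x y d p) =
  homog (map_poly f x) (map_poly f y) d (map_poly f p).
Proof.
rewrite /homog rmorph_sum; apply: eq_bigr => i _ /=.
by rewrite map_polyZ coef_map rmorphM !rmorphXn.
Qed.

Section Descent.
Local Notation X := ('X^2 + 'X).
Local Notation Z := ('X^2 + 'X + 1).

(** With x = X^(2^j) the right side is (1 + x)^2 modulo 4, and (1 + x)^4 = 1 + 2 x^2 + x^4 modulo 4
    is the induction step. *)
Lemma exprZ_mod4 j : exists v : {poly int},
  Z ^+ (2 ^ j.+1) = 1 + X ^+ (2 ^ j) *+ 2 + X ^+ (2 ^ j.+1) + v *+ 4.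
Proof.
elim: j => [|j [v hv]]; first by exists 0; rewrite !expr1; ring.
exists (X ^+ (2 ^ j) + X ^+ (2 ^ j.+1) + X ^+ (2 ^ j.+1) * X ^+ (2 ^ j) +
  v * (1 + X ^+ (2 ^ j) *+ 2 + X ^+ (2 ^ j.+1)) *+ 2 + v ^+ 2 *+ 4).
rewrite [in LHS]expnSr exprM hv.
have e k : X ^+ (2 ^ k.+1) = (X ^+ (2 ^ k)) ^+ 2 :> {poly int} by rewrite expnSr exprM.
rewrite !e; ring.
Qed.

(** The homogenized factors are Z^(2^j) - X^(2^j): the first is 1 and, by [exprZ_mod4], the others
    are 1 + 2 X^(2^(j-1)) modulo 4. *)
Lemma homog_tm_poly l : exists u : {poly int},
  homog X Z (2 ^ l.+1).-1 (tm_poly l.+1) =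
  1 + (\sum_(j < l) X ^+ (2 ^ j)) *+ 2 + u *+ 4.
Proof.
elim: l => [|l [u hu]].
  exists 0; rewrite tm_polyS /tm_poly !big_ord0 mul1r homog_oneBXn; ring.
have [v hv] := exprZ_mod4 l; pose S : {poly int} := \sum_(j < l) X ^+ (2 ^ j).
exists (u + v + S * X ^+ (2 ^ l) + u * X ^+ (2 ^ l) *+ 2 + S * v *+ 2 + u * v *+ 4).
have -> : ((2 ^ l.+2).-1 = (2 ^ l.+1).-1 + 2 ^ l.+1)%N.
  have : (0 < 2 ^ l.+1)%N by rewrite expn_gt0.
  by rewrite [in X in _ -> X = _]expnSr; lia.
rewrite tm_polyS homogM ?size_oneBXn ?prednK ?expn_gt0 ?size_tm_poly //.
rewrite hu homog_oneBXn hv big_ord_recr -/S /=; ring.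
Qed.

Lemma mod2_tm_poly l : (1 + 'X) * mod2 (tm_poly l) = 1 + 'X^(2 ^ l).
Proof.
have c2 : 2%N \in [pchar 'F_2] by rewrite pchar_Fp.
have two0 : 2%:R = 0 :> {poly 'F_2} by apply: (@pcharf0 _ 2); rewrite pchar_poly.
elim: l => [|l ih]; first by rewrite /tm_poly big_ord0 rmorph1 mulr1 expn0 expr1.
rewrite tm_polyS rmorphM mulrA /= ih rmorphB rmorph1 /= map_polyXn expnSr exprM.
have -> : (1 + 'X^(2 ^ l)) * (1 - 'X^(2 ^ l)) =
  1 + ('X^(2 ^ l)) ^+ 2 - ('X^(2 ^ l)) ^+ 2 * 2%:R :> {poly 'F_2} by ring.
by rewrite two0 mulr0 subr0.
Qed.

Lemma poly_int_double_inj : injective (fun p : {poly int} => p *+ 2).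
Proof.
move=> p q /= e; apply/polyP => i; have := congr1 (fun r : {poly int} => r`_i) e.
by rewrite !coefMn; lia.
Qed.

Lemma XnM_small (R : idomainType) N (p q : {poly R}) :
  (size p <= N)%N -> p = 'X^N * q -> p = 0.
Proof.
move=> sp e; have [q0|q0] := eqVneq q 0; first by rewrite e q0 mulr0.
move: sp; rewrite e mulrC size_mulXn // -{2}[N]addn0 leq_add2l leqn0.
by rewrite size_poly_eq0 (negbTE q0).
Qed.

(** In characteristic two X^(2^j) = z^(2^(j+1)) + z^(2^j), and the sum telescopes. *)
Lemma sum_frobenius (l : nat) :
  \sum_(j < l) X ^+ (2 ^ j) = 'X + 'X^(2 ^ l) :> {poly 'F_2}.
Proof.
have c2 : 2%N \in [pchar 'F_2] by rewrite pchar_Fp.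
have two0 : 2%:R = 0 :> {poly 'F_2} by apply: (@pcharf0 _ 2); rewrite pchar_poly.
elim: l => [|l ih].
  by rewrite big_ord0 expn0 expr1 -mulr2n -mulr_natr two0 mulr0.
rewrite big_ord_recr ih /= exprDn_char2 // -exprM -expnS.
have -> : 'X + 'X^(2 ^ l) + ('X^(2 ^ l.+1) + 'X^(2 ^ l)) =
  'X + 'X^(2 ^ l.+1) + 'X^(2 ^ l) * 2%:R :> {poly 'F_2} by ring.
by rewrite two0 mulr0 addr0.
Qed.

(* Modulo 2 the product is 1 / (1 - w), a rational function, so that the
   obstruction has to be read off modulo 4: one writes B = (1 - w) A + 2 E. *)
Lemma tm_poly_descent l m n (A B C : {poly int}) :
  (m + n = 2 ^ l)%N -> (size A <= m)%N -> (size B <= n)%N ->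
  B * tm_poly l = A + 'X^(2 ^ l) * C -> mod2 A = 0 /\ mod2 B = 0.
Proof.
set N := (2 ^ l)%N => mnN sA sB BPA.
have c2 : 2%N \in [pchar 'F_2] by rewrite pchar_Fp.
have sA2 : (size (mod2 A) <= m)%N by rewrite (leq_trans (size_poly _ _)).
have sB2 : (size (mod2 B) <= n)%N by rewrite (leq_trans (size_poly _ _)).
(* Modulo 2, (1 + w) P_l = 1 + w^N, so B and (1 + w) A agree modulo w^N; for n > 0 both have size at
   most N. *)
have mB : mod2 B = (1 + 'X) * mod2 A.
  have [n0|n0] := posnP n.
    have B0 : B = 0 by apply/eqP; rewrite -size_poly_eq0 -leqn0 -n0.
    have -> : A = 0.
      apply: (@XnM_small _ N _ (- C)); first by rewrite -mnN n0 addn0.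
      by apply/eqP; rewrite mulrN -addr_eq0 -BPA B0 mul0r.
    by rewrite B0 !rmorph0 mulr0.
  apply/eqP; rewrite -subr_eq0; apply/eqP.
  apply: (@XnM_small _ N _ ((1 + 'X) * mod2 C - mod2 B)).
    rewrite (leq_trans (size_polyD _ _)) // geq_max size_polyN.
    rewrite (leq_trans sB2) -?mnN ?leq_addl //=.
    have s2 : (size (1 + 'X : {poly 'F_2})%R <= 2)%N by rewrite [1 + _]addrC size_XaddC.
    by apply: leq_trans (size_polyM_le s2 sA2) _; move: n0; lia.
  have := congr1 (fun p => (1 + 'X) * mod2 p) BPA.
  rewrite rmorphM /= mulrCA mod2_tm_poly rmorphD rmorphM /= map_polyXn -/N => h.
  transitivity (mod2 B * (1 + 'X^N) - 'X^N * mod2 B - (1 + 'X) * mod2 A); first by ring.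
  rewrite h; ring.
suff A0 : mod2 A = 0 by rewrite mB A0 mulr0.
(* By [mB] the reduction of A has size at most n - 1 as well as m, and e bounds the size of E; a + e
   = N as soon as a > 0. *)
pose a := minn m n.-1; pose e := maxn n m.+1.
have sAa : (size (mod2 A) <= a)%N.
  rewrite leq_min sA2 /=; have [->|A0] := eqVneq (mod2 A) 0; first by rewrite size_poly0.
  have s2 : size (1 + 'X : {poly 'F_2}) = 2%N by rewrite [1 + _]addrC size_XaddC.
  move: sB2; rewrite mB size_mul // ?s2; last by rewrite -size_poly_eq0 s2.
  by move: (size _) => k; lia.
have [a0|a0] := posnP a; first by move: sAa; rewrite a0 size_poly_leq0 => /eqP.
have aeN : (a + e = N)%N by move: a0 mnN; rewrite /a /e; lia.
have ae : (a < e)%N by move: a0 mnN; rewrite /a /e; lia.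
have [E hE] : exists E, B - (1 - 'X) * A = E *+ 2.
  apply: mod2_eq0; rewrite rmorphB rmorphM rmorphB /= mB rmorph1 map_polyX.
  have -> : (1 + 'X) * mod2 A - (1 - 'X) * mod2 A = ('X * mod2 A) *+ 2 by ring.
  rewrite -mulr_natr (_ : 2%:R = 0) ?mulr0 //.
  by apply: (@pcharf0 _ 2); rewrite pchar_poly.
have sE : (size E <= e)%N.
  have -> : size E = size (E *+ 2).
    by rewrite -scaler_nat size_scale.
  rewrite -hE (leq_trans (size_polyD _ _)) // geq_max size_polyN.
  rewrite (leq_trans sB) ?leq_maxl //=.
  by rewrite (leq_trans (size_polyM_le (size_oneBXn _ 1) sA)) // leq_maxr.
(* Substituting B = (1 - w) A + 2 E gives w^N C = A ((1 - w) P_l - 1) + 2 E P_l, homogenized here in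
   degree e - 2 + N; the factor 1 - w becomes Z - X = 1. *)
have hom : exists hC : {poly int}, homog X Z e.-2 A *
    (homog X Z N.-1 (tm_poly l) - Z ^+ N) + homog X Z e.-1 E *
    homog X Z N.-1 (tm_poly l) *+ 2 = X ^+ N * hC.
  have N0 : (0 < N)%N by rewrite expn_gt0.
  exists (homog X Z e.-2 C).
  have sP : (size (tm_poly l) <= N.-1.+1)%N by rewrite prednK // size_tm_poly.
  have sE1 : (size E <= e.-1.+1)%N by apply: leq_trans sE _; lia.
  have sA1 : (size A <= e.-2.+1)%N.
    by apply: leq_trans sA _; move: a0; rewrite /a /e; lia.
  have sC : (size C <= e.-2.+1)%N.
    have [->|C0] := eqVneq C 0; first by rewrite size_poly0.
    have : (size ('X^N * C)%R <= maxn (n + N).-1 m)%N.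
      have -> : 'X^N * C = B * tm_poly l - A by rewrite BPA; ring.
      rewrite (leq_trans (size_polyD _ _)) // geq_max size_polyN !leq_max sA orbT.
      by rewrite (size_polyM_le sB) // size_tm_poly.
    by rewrite mulrC size_mulXn //; move: a0 mnN; rewrite /a /e; move: (size _) => k; lia.
  have oneX : homog X Z 1 (1 - 'X) = 1 :> {poly int}.
    by rewrite (homog_oneBXn (X : {poly int}) Z 1 : homog _ _ 1 (1 - 'X) = _); ring.
  have sX : (size (1 - 'X : {poly int})%R <= 2)%N by exact: (size_oneBXn _ 1).
  have id : 'X^N * C = A * ((1 - 'X) * tm_poly l) + (- A + (E * tm_poly l + E * tm_poly l)).
    rewrite -[_ + E * _]mulr2n -mulrnAl -hE; transitivity (B * tm_poly l - A); last by ring.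
    by rewrite BPA; ring.
  have := congr1 (homog X Z (e.-2 + N)) id.
  rewrite ![homog _ _ _ (_ + _)]homogD -[- A]scaleN1r homogZ [homog _ _ _ A]homog_lead //.
  rewrite [homog _ _ _ (A * _)]homogM //; last first.
    by rewrite (leq_trans (size_polyM_le sX sP)) // prednK.
  rewrite -[in X in X * homog _ _ _ _]/N.
  have -> : homog X Z N ((1 - 'X) * tm_poly l) = homog X Z N.-1 (tm_poly l).
    transitivity (homog X Z 1 (1 - 'X) * homog X Z N.-1 (tm_poly l)).
      by rewrite -homogM // add1n prednK.
    by rewrite oneX mul1r.
  have -> : homog X Z (e.-2 + N) (E * tm_poly l) =
      homog X Z e.-1 E * homog X Z N.-1 (tm_poly l).
    by rewrite -homogM //; congr homog; move: ae a0 N0; lia.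
  rewrite [(e.-2 + N)%N]addnC homogM ?size_polyXn // homogXn // subnn expr0 mulr1 => ->.
  rewrite scaleN1r; ring.
have [hC {}hom] := hom.
case: l @N mnN BPA aeN hom => [|l] N mnN BPA aeN hom; first by move: aeN a0 ae; rewrite /N; lia.
have [u hu] := homog_tm_poly l; have [v hv] := exprZ_mod4 l.
pose S : {poly int} := \sum_(j < l) X ^+ (2 ^ j).
pose hA := homog X Z e.-2 A; pose hE2 := homog X Z e.-1 E.
(* Modulo 4 the factor of [hA] in [hom] is -X^N plus an even polynomial; moving the term in X^N to
   the right leaves an even left side. *)
have key : (hA * (S - X ^+ (2 ^ l) + u *+ 2 - v *+ 2) +
   hE2 * homog X Z N.-1 (tm_poly l.+1)) *+ 2 = X ^+ N * (hC + hA).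
  by rewrite [RHS]mulrDr -hom hu /N hv -/S -/hA -/hE2; ring.
have [D hD] : exists D, hC + hA = D *+ 2.
  apply: mod2_eq0; apply/eqP.
  have := mod2_double (hA * (S - X ^+ (2 ^ l) + u *+ 2 - v *+ 2) +
   hE2 * homog X Z N.-1 (tm_poly l.+1)).
  rewrite key rmorphM rmorphXn rmorphD /= map_polyXn map_polyX => /eqP.
  have x0 : 'X^2 + 'X != 0 :> {poly 'F_2}.
    by rewrite -size_poly_eq0 size_polyDl ?size_polyXn ?size_polyX.
  by rewrite mulf_eq0 expf_eq0 (negbTE x0) andbF.
have {}key : hA * (S - X ^+ (2 ^ l) + u *+ 2 - v *+ 2) +
   hE2 * homog X Z N.-1 (tm_poly l.+1) = X ^+ N * D.
  by apply: poly_int_double_inj; rewrite key hD mulrnAr.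
apply: (@char2_nonsingular _ c2 l.+1 a e _ (mod2 E)) => //.
  by rewrite (leq_trans (size_poly _ _)).
have := congr1 mod2 key; pose x : {poly 'F_2} := X.
have mX : mod2 X = x by rewrite rmorphD /= map_polyXn map_polyX.
have mZ : mod2 Z = x + 1 by rewrite rmorphD /= mX rmorph1.
have d0 (w : {poly int}) : mod2 (w *+ 2) = 0 := mod2_double w.
have -> : mod2 (hA * (S - X ^+ (2 ^ l) + u *+ 2 - v *+ 2) +
    hE2 * homog X Z N.-1 (tm_poly l.+1)) =
    homog X Z e.-2 (mod2 A) * ('X + 'X^N) + homog X Z e.-1 (mod2 E).
  rewrite hu -/S.
  have -> : 1 + S *+ 2 + u *+ 4 = 1 + (S + u *+ 2) *+ 2 by ring.
  have one2 : mod2 (1 + (S + u *+ 2) *+ 2) = 1 by rewrite rmorphD rmorph1 /= d0 addr0.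
  rewrite rmorphD !rmorphM /= one2 mulr1 !map_homog mX mZ.
  congr (_ * _ + _); rewrite -sum_frobenius big_ord_recr /=.
  have -> : S - X ^+ (2 ^ l) + u *+ 2 - v *+ 2 =
    (S + X ^+ (2 ^ l)) + (u - v - X ^+ (2 ^ l)) *+ 2 by ring.
  rewrite rmorphD /= d0 addr0 rmorphD rmorph_sum rmorphXn /= mX; congr (_ + _).
  by apply: eq_bigr => j _; rewrite rmorphXn /= mX.
rewrite rmorphM rmorphXn /= mX => e1.
(* As X^N = z^N (z + 1)^N, moving the term in z^N to the right gives the relation required by
   [char2_nonsingular]. *)
exists (('X + 1) ^+ N * mod2 D - homog X Z e.-2 (mod2 A)).
have xN : x ^+ N = 'X^N * ('X + 1) ^+ N by rewrite -exprMn; congr (_ ^+ N); rewrite /x; ring.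
rewrite mulrBr mulrA -xN -e1; ring.
Qed.
End Descent.

(** Infinite descent: by [tm_poly_descent] A and B are even, hence so is C, and halving all three
    preserves the hypotheses. Thus every power of 2 divides every coefficient. *)
Lemma tm_nonsingular l m n (A B C : {poly int}) :
  (m + n = 2 ^ l)%N -> (size A <= m)%N -> (size B <= n)%N ->
  B * tm_poly l = A + 'X^(2 ^ l) * C -> A = 0 /\ B = 0.
Proof.
move=> mn sA sB e.
have size2 (p : {poly int}) : size (p *+ 2) = size p by rewrite -scaler_nat size_scale.
have div k i : (2 ^+ k %| A`_i)%Z /\ (2 ^+ k %| B`_i)%Z.
  elim: k A B C sA sB e => [|k ih] A B C sA sB e; first by rewrite expr0 !dvd1z.
  have [/mod2_eq0[A1 eA] /mod2_eq0[B1 eB]] := tm_poly_descent mn sA sB e.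
  have [C1 eC] : exists C1, C = C1 *+ 2.
    apply: mod2_eq0; have := congr1 mod2 e.
    rewrite eA eB mulrnAl mod2_double rmorphD /= mod2_double add0r rmorphM /= map_polyXn.
    by move/esym/eqP; rewrite mulf_eq0 -size_poly_eq0 size_polyXn /= => /eqP.
  have [] := ih A1 B1 C1; rewrite -?(size2 A1) -?(size2 B1) -?eA -?eB //.
    by apply: poly_int_double_inj; rewrite mulrnDl -mulrnAl -[in RHS]mulrnAr -eA -eB -eC.
  have d2 (c : int) : c *+ 2 = c * 2 by lia.
  by rewrite eA eB !coefMn => dA dB; rewrite (d2 A1`_i) (d2 B1`_i) exprSr !dvdz_mul.
have zero (c : int) : (forall k, 2 ^+ k %| c)%Z -> c = 0.
  move=> h; apply/eqP; apply: contraT => c0; have := h `|c|%N.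
  rewrite dvdzE abszX => /dvdn_leq; rewrite absz_gt0 c0 => /(_ isT).
  by rewrite leqNgt ltn_expl.
by split; apply/polyP => i; rewrite coef0; apply: zero => k; have [] := div k i.
Qed.

(** * Pade approximants of the Thue-Morse products *)

Lemma tm_pade l al be : (al + be = 2 ^ l)%N -> exists A B C : {poly int},
  [/\ B != 0, (size A <= al)%N, (size B <= be.+1)%N &
      B * tm_poly l = A + 'X^(2 ^ l) * C].
Proof.
set N := (2 ^ l)%N => abN.
(* The be vanishing conditions are linear in the be + 1 coefficients of B, so a rational solution
   exists; its denominators are cleared afterwards. *)
pose M : 'M[rat]_(be.+1, be) := \matrix_(i, j) (('X^i * tm_poly l)`_(al + j))%:~R.
have /rowV0Pn[v /sub_kermxP vM v0] : kermx M != 0.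
  by rewrite kermx_eq0 /row_free neq_ltn ltnS rank_leq_col.
have [B [a a0 vB]] := rat_poly_scale (rVpoly v).
have BE : map_poly intr B = a%:~R *: rVpoly v by rewrite vB scalerA divff ?intr_eq0 // scale1r.
have inj : injective (intr : int -> rat) := intr_inj.
have sB : (size B <= be.+1)%N.
  rewrite -(size_map_inj_poly inj) // BE (leq_trans (size_scale_leq _ _)) //.
  exact: size_poly.
have cB j : (j < be)%N -> (B * tm_poly l)`_(al + j) = 0.
  move=> jb; apply: inj; rewrite -coef_map rmorphM /= BE -scalerAl coefZ rmorph0.
  rewrite (_ : _`_(al + j) = 0) ?mulr0 //.
  rewrite (@poly_expand _ be.+1 (rVpoly v)) ?size_poly // mulr_suml coef_sum.
  have := congr1 (fun w : 'rV_be => w 0 (Ordinal jb)) vM; rewrite !mxE => vM0; rewrite -[RHS]vM0.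
  apply: eq_bigr => i _; rewrite mxE coef_rVpoly_ord -scalerAl coefZ -coef_map.
  by rewrite rmorphM /= map_polyXn.
exists (take_poly N (B * tm_poly l)), B, (drop_poly N (B * tm_poly l)); split => //.
- apply: contra v0 => /eqP B0; have := BE; rewrite B0 rmorph0 => /esym/eqP.
  rewrite scaler_eq0 intr_eq0 (negbTE a0) /= => /eqP r0.
  by rewrite -[v]rVpolyK r0 linear0.
- apply/leq_sizeP => i ali; rewrite coef_take_poly; case: ifP => // iN.
  by rewrite -(subnKC ali) cB //; lia.
- by rewrite [_ * drop_poly _ _]mulrC poly_take_drop.
Qed.

(** The determinant is divisible by w^N and has degree at most N. Its coefficient there is the
    product of the leading coefficients of A and B', whose degrees are maximal by
    [tm_nonsingular]. *)
Lemma tm_pade_adjacent l al be (A B C A' B' C' : {poly int}) :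
  (al.+1 + be = 2 ^ l)%N -> B != 0 -> B' != 0 ->
  (size A <= al.+1)%N -> (size B <= be.+1)%N ->
  (size A' <= al)%N -> (size B' <= be.+2)%N ->
  B * tm_poly l = A + 'X^(2 ^ l) * C -> B' * tm_poly l = A' + 'X^(2 ^ l) * C' ->
  exists2 c, c != 0 & A * B' - A' * B = c *: 'X^(2 ^ l).
Proof.
set N := (2 ^ l)%N => abN B0 B0' sA sB sA' sB' e e'.
have sizeE (p : {poly int}) k : (size p <= k.+1)%N -> ~~ (size p <= k)%N -> size p = k.+1.
  by move=> h1 h2; apply/eqP; rewrite eqn_leq h1 ltnNge.
have {}sA : size A = al.+1.
  apply: sizeE => //; apply: contra B0 => h; apply/eqP.
  by case: (@tm_nonsingular l al be.+1 A B C) => //; lia.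
have {}sB' : size B' = be.+2.
  apply: sizeE => //; apply: contra B0' => h; apply/eqP.
  by case: (@tm_nonsingular l al be.+1 A' B' C') => //; lia.
have X0 : 'X^N != 0 :> {poly int} by rewrite -size_poly_eq0 size_polyXn.
set D := A * B' - A' * B.
have DE : D = 'X^N * (C' * B - C * B').
  have eA : A = B * tm_poly l - 'X^N * C by rewrite e; ring.
  have eA' : A' = B' * tm_poly l - 'X^N * C' by rewrite e'; ring.
  rewrite /D eA eA'; ring.
have DN : D`_N = lead_coef A * lead_coef B'.
  rewrite coefB mul_lead_coef sA sB' addSn addnS /= [X in _ - X]nth_default.
    by rewrite subr0; congr _`_ _; lia.
  by rewrite (leq_trans (size_polyM_le sA' sB)) //; lia.
have sD : (size D <= N.+1)%N.
  rewrite (leq_trans (size_polyD _ _)) // size_polyN geq_max.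
  rewrite (leq_trans (size_polyM_le (leqnn _) (leqnn _))) ?sA ?sB' /=; last by lia.
  by apply: leq_trans (size_polyM_le sA' sB) _; lia.
set K := C' * B - C * B' in DE.
have sK : (size K <= 1)%N.
  have [->|K0] := eqVneq K 0; first by rewrite size_poly0.
  by move: sD; rewrite DE mulrC size_mulXn //; lia.
exists (lead_coef A * lead_coef B').
  by rewrite mulf_neq0 // lead_coef_eq0 -size_poly_eq0 ?sA ?sB'.
rewrite -DN DE mulrC coefMXn ltnn subnn.
by rewrite [in LHS](size1_polyC sK) mul_polyC.
Qed.

(** * Comparison of p-adic approximations *)

Section PadicApproximation.
Variables (R : realType) (p : nat) (p_prime : prime p).
Local Notation xi := (thue_morse_padic R p).
Local Notation err a b := (padic_norm ((b : int)%:~R * xi - (a : int)%:~R)).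
Implicit Types (a b r s : int).

Lemma padic_norm_ultra (x y : padic R p) :
  padic_norm (x + y) <= Num.max (padic_norm x) (padic_norm y).
Proof.
rewrite -[x]reprK -[y]reprK -raddfD !padic_normE.
set u := repr x; set v := repr y.
apply/ler_addgt0Pr => e e0; apply: limr_le; first exact: padic_seq_cvg.
have close (w : padic_seq R p) : \forall n \near \oo,
    ratpnorm R p (padic_seq_val w n) < limn (fun n => ratpnorm R p (w n)) + e.
  have /cvgrPdist_lt /(_ _ e0) := @padic_seq_cvg R p w; apply: filterS => n.
  by rewrite ltr_norml => /andP[+ _]; lra.
near=> n; apply: (le_trans (ratpnorm_ultra _ _ _ _)).
have un : ratpnorm R p (u n) < limn (fun n => ratpnorm R p (u n)) + e by near: n; exact: close.
have vn : ratpnorm R p (v n) < limn (fun n => ratpnorm R p (v n)) + e by near: n; exact: close.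
rewrite ge_max; apply/andP; split.
  by rewrite (le_trans (ltW un)) // lerD2r le_max lexx.
by rewrite (le_trans (ltW vn)) // lerD2r le_max lexx orbT.
Unshelve. all: by end_near. Qed.

Lemma padic_norm_int_le1 a : padic_norm (a%:~R : padic R p) <= 1.
Proof. by rewrite padic_norm_int ratpnorm_int_le1. Qed.

Lemma padic_norm_intE a : a != 0 ->
  padic_norm (a%:~R : padic R p) = ((p ^ logn p `|a|)%N%:R)^-1.
Proof.
move=> a0; rewrite padic_norm_int /ratpnorm intr_eq0 (negbTE a0) /padicval.
by rewrite numq_int denq_int /= logn1 subr0 -exprnN natrX.
Qed.

Lemma padic_norm_int_le a n :
  (padic_norm (a%:~R : padic R p) <= ((p ^ n)%N%:R)^-1) = (p ^ n %| `|a|)%N.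
Proof.
have pn0 k : (0 : R) < (p ^ k)%N%:R by rewrite ltr0n expn_gt0 prime_gt0.
have [->|a0] := eqVneq a 0; first by rewrite padic_norm0 dvdn0 invr_ge0 ltW.
rewrite padic_norm_intE // lef_pV2 ?posrE // ler_nat leq_exp2l ?prime_gt1 //.
by rewrite pfactor_dvdn // absz_gt0.
Qed.

Lemma padic_norm_int_ge a : a != 0 ->
  (`|a|%N%:R)^-1 <= padic_norm (a%:~R : padic R p).
Proof.
move=> a0; rewrite padic_norm_intE // lef_pV2 ?posrE ?ltr0n ?absz_gt0 //.
by rewrite ler_nat dvdn_leq ?absz_gt0 // pfactor_dvdnn.
Qed.

Definition tm_sum n : int := \sum_(k < n) thue_morse k * p%:R ^+ k.

Lemma tm_sum_cvg : (tm_sum n)%:~R @[n --> \oo] --> xi.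
Proof.
have e : (fun n => (tm_sum n)%:~R) =
    series (fun n => (thue_morse n)%:~R * p%:R ^+ n) :> (nat -> padic R p); last first.
  by rewrite e; exact: thue_morse_padic_cvg.
apply/funext => n; rewrite /series /= big_mkord rmorph_sum; apply: eq_bigr => k _.
by rewrite rmorphM rmorphXn rmorph_nat.
Qed.

Lemma tm_sum_dvd m n : (n <= m)%N -> (p ^ n %| `|tm_sum m - tm_sum n|)%N.
Proof.
move=> nm; have -> : tm_sum m - tm_sum n =
    (p ^ n)%N%:Z * \sum_(n <= k < m) thue_morse k * p%:R ^+ (k - n).
  rewrite /tm_sum -!(big_mkord xpredT (fun k => thue_morse k * p%:R ^+ k)).
  rewrite (big_cat_nat (leq0n n) nm) /= addrAC subrr add0r mulr_sumr.
  apply: eq_big_nat => k /andP[nk _].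
  by rewrite mulrCA -[X in _ = _ * (X * _)]natz natrX -exprD subnKC.
by rewrite abszM dvdn_mulr.
Qed.

Lemma tm_sum_err n : padic_norm (xi - (tm_sum n)%:~R) <= ((p ^ n)%N%:R)^-1.
Proof.
apply/ler_addgt0Pr => e e0.
have /metricType_numDomainType.cvgrPdist_lt /(_ _ e0)[m _ h] := tm_sum_cvg.
have {}h := h (maxn m n) (leq_maxl _ _); set w := (maxn m n) in h.
rewrite -[xi - _](subrKA (tm_sum w)%:~R) addrC (le_trans (padic_norm_triangle _ _)) //.
by apply: lerD; [rewrite -rmorphB padic_norm_int_le tm_sum_dvd // leq_maxr | exact: ltW].
Qed.

(** Since xi differs from [tm_sum m] by at most p^(-m), comparing the error with p^(-n) for n <= m
    is a divisibility question on an integer. *)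
Lemma err_le a b n m : (n <= m)%N -> (p ^ n %| `|(b * tm_sum m - a)%R|)%N ->
  err a b <= ((p ^ n)%N%:R)^-1.
Proof.
move=> nm dv; have -> : b%:~R * xi - a%:~R =
    (b * tm_sum m - a)%:~R + b%:~R * (xi - (tm_sum m)%:~R).
  by rewrite rmorphB rmorphM /=; ring.
apply: (le_trans (padic_norm_ultra _ _)); rewrite ge_max padic_norm_int_le dv /=.
rewrite padic_normM -[leRHS]mul1r ler_pM ?padic_norm_ge0 ?padic_norm_int_le1 //.
apply: (le_trans (tm_sum_err m)); rewrite lef_pV2 ?posrE ?ltr0n ?expn_gt0 ?prime_gt0 //.
by rewrite ler_nat leq_exp2l ?prime_gt1.
Qed.

Lemma err_ge a b n m : (n <= m)%N -> ~~ (p ^ n %| `|(b * tm_sum m - a)%R|)%N ->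
  ((p ^ n)%N%:R)^-1 < err a b.
Proof.
move=> nm; apply: contraR; rewrite -leNgt -padic_norm_int_le => h.
have -> : (b * tm_sum m - a)%:~R =
    (b%:~R * xi - a%:~R) - b%:~R * (xi - (tm_sum m)%:~R).
  by rewrite rmorphB rmorphM /=; ring.
apply: (le_trans (padic_norm_ultra _ _)); rewrite ge_max h /= padic_normN.
rewrite padic_normM -[leRHS]mul1r ler_pM ?padic_norm_ge0 ?padic_norm_int_le1 //.
apply: (le_trans (tm_sum_err m)); rewrite lef_pV2 ?posrE ?ltr0n ?expn_gt0 ?prime_gt0 //.
by rewrite ler_nat leq_exp2l ?prime_gt1.
Qed.

(** The nonzero integer a s - b r is at most D in absolute value, so its norm is at least 1/D. It
    equals b (s xi - r) - s (b xi - a), whose second term is smaller than 1/D; hence the first is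
    not. *)
Lemma err_compare a b r s n D : err a b <= ((p ^ n)%N%:R)^-1 -> a * s != b * r ->
  (`|a| * `|s| + `|b| * `|r| <= D)%N -> (D < p ^ n)%N -> (D%:R)^-1 <= err r s.
Proof.
move=> ab ne leD Dn; rewrite leNgt; apply/negP => lt.
have z0 : a * s - b * r != 0 by rewrite subr_eq0.
have zD : (`|(a * s - b * r)%R| <= D)%N.
  by apply: leq_trans leD; rewrite -!abszM; lia.
have D0 : (0 < D)%N by apply: leq_trans zD; rewrite absz_gt0.
have := padic_norm_int_ge z0; rewrite leNgt => /negP; apply.
have -> : (a * s - b * r)%:~R = b%:~R * (s%:~R * xi - r%:~R) +
    - (s%:~R * (b%:~R * xi - a%:~R)) :> padic R p by rewrite rmorphB !rmorphM /=; ring.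
apply: (@lt_le_trans _ _ (D%:R^-1)); last first.
  by rewrite lef_pV2 ?posrE ?ltr0n ?absz_gt0 // ler_nat.
apply: (le_lt_trans (padic_norm_ultra _ _)); rewrite gt_max padic_normN !padic_normM.
have le1 c x : padic_norm (c%:~R : padic R p) * padic_norm (x : padic R p) <= padic_norm x.
  by rewrite ler_piMl ?padic_norm_ge0 ?padic_norm_int_le1.
rewrite (le_lt_trans (le1 _ _) lt) (le_lt_trans (le1 _ _)) //.
apply: (le_lt_trans ab); rewrite ltf_pV2 ?posrE ?ltr0n //; last exact: leq_ltn_trans Dn.
by rewrite ltr_nat.
Qed.
End PadicApproximation.

(** * Values of the products and of the approximants at powers of p *)

Lemma thue_morse_add_pow2 j k : (k < 2 ^ j)%N ->
  thue_morse (2 ^ j + k) = - thue_morse k.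
Proof.
elim: j k => [|j ih] k; first by case: k.
rewrite -{2 3}(odd_double_half k) expnS => kj.
have hk : (k./2 < 2 ^ j)%N by lia.
have -> : (2 * 2 ^ j + (odd k + k./2.*2) = odd k + (2 ^ j + k./2).*2)%N by lia.
by case: (odd k); rewrite ?add0n ?add1n ?thue_morse_doubleS ?thue_morse_double ih.
Qed.

Lemma horner_tm_poly k (x : int) : (tm_poly k).[x] = \prod_(j < k) (1 - x ^+ (2 ^ j)).
Proof.
rewrite /tm_poly horner_prod; apply: eq_bigr => j _.
by rewrite !hornerE.
Qed.

Lemma horner_tm_polyD k l (x : int) :
  (tm_poly (k + l)).[x] = (tm_poly k).[x] * (tm_poly l).[x ^+ (2 ^ k)].
Proof.
rewrite !horner_tm_poly big_split_ord /=; congr (_ * _).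
by apply: eq_bigr => j _; rewrite -exprM -expnD.
Qed.

Lemma tm_sum_pow2 p j : tm_sum p (2 ^ j) = (tm_poly j).[p%:R].
Proof.
rewrite horner_tm_poly; elim: j => [|j ih].
  by rewrite /tm_sum big_ord1 big_ord0 expr0 mulr1.
rewrite big_ord_recr /= -ih /tm_sum expnS mul2n -addnn big_split_ord /=.
rewrite mulrBr mulr1; congr (_ + _); rewrite mulr_suml -sumrN; apply: eq_bigr => k _.
by rewrite thue_morse_add_pow2 // exprD; ring.
Qed.

(** A sum rather than a maximum, so that [horner_height] holds without a factor depending on the
    degree. *)
Definition poly_height (f : {poly int}) : nat := \sum_(i < size f) `|(f`_i)%R|.

Lemma horner_height (f : {poly int}) (q m : nat) : (0 < q)%N ->
  (size f <= m.+1)%N -> (`|f.[q%:R]| <= poly_height f * q ^ m)%N.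
Proof.
move=> q0 sf; rewrite horner_coef /poly_height big_distrl /=.
have absS (I : finType) (g : I -> int) : (`|(\sum_i g i)%R| <= \sum_i `|(g i)%R|)%N.
  by elim/big_rec2: _ => // i y x _ h; lia.
apply: leq_trans (absS _ _) _; apply: leq_sum => i _.
rewrite abszM leq_mul2l; apply/orP; right.
by rewrite -natrX natz absz_nat leq_pexp2l // -ltnS (leq_trans (ltn_ord i)).
Qed.

Section Pade.
Variables (R : realType) (p : nat) (p_prime : prime p).
Local Notation xi := (thue_morse_padic R p).
Local Notation err a b := (padic_norm ((b : int)%:~R * xi - (a : int)%:~R)).
Local Notation q k := (p ^ (2 ^ k))%N.

Definition pade_num k (A : {poly int}) : int := (tm_poly k).[p%:R] * A.[(q k)%:R].
Definition pade_den k (B : {poly int}) : int := B.[(q k)%:R].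

Lemma qS k : q k.+1 = (q k ^ 2)%N. Proof. by rewrite -expnM expnSr. Qed.

Lemma q_gt0 k : (0 < q k)%N. Proof. by rewrite expn_gt0 prime_gt0. Qed.

Lemma q_ge2 k : (2 <= q k)%N.
Proof.
apply: (leq_trans (prime_gt1 p_prime)); rewrite -[X in (X <= _)%N]expn1.
by rewrite leq_pexp2l ?expn_gt0 ?prime_gt0.
Qed.

Lemma abs_one_sub_q k : `|1 - (p%:R : int) ^+ (2 ^ k)|%N = (q k - 1)%N.
Proof. by rewrite -natrX natz; have := q_gt0 k; lia. Qed.

Lemma abs_tm_polyS k : `|(tm_poly k.+1).[p%:R : int]|%N =
  (`|(tm_poly k).[p%:R : int]| * (q k - 1))%N.
Proof. by rewrite !horner_tm_poly big_ord_recr /= abszM abs_one_sub_q. Qed.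

Lemma abs_tm_poly_le k : (`|(tm_poly k).[p%:R : int]| <= q k)%N.
Proof.
elim: k => [|k ih]; first by rewrite horner_tm_poly big_ord0 q_gt0.
by rewrite abs_tm_polyS qS leq_mul // leq_subr.
Qed.

Lemma abs_tm_poly_gt0 k : (0 < `|(tm_poly k).[p%:R : int]|)%N.
Proof.
elim: k => [|k ih]; first by rewrite horner_tm_poly big_ord0.
by rewrite abs_tm_polyS muln_gt0 ih subn_gt0 q_ge2.
Qed.

(** The summand 2 makes the induction work: |P_k(p)| gains the factor q - 1, and (q + 2)(q - 1) >=
    q^2 + 2 once q >= 4, that is from k = 1 on. *)
Lemma abs_tm_poly_ge k : (q k + 2 <= (p ^ 2 + 2) * `|(tm_poly k).[p%:R : int]|)%N.
Proof.
have p2 := prime_gt1 p_prime.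
case: k => [|k]; first by rewrite horner_tm_poly big_ord0 expn0 expn1; nia.
elim: k => [|k ih].
  by rewrite abs_tm_polyS horner_tm_poly big_ord0 expn0 !expn1; nia.
have q4 : (4 <= q k.+1)%N by rewrite qS; have := q_ge2 k; nia.
rewrite abs_tm_polyS qS; move: ih q4; move: (`|_|)%N (q k.+1) => u v; nia.
Qed.

(** Evaluating the identity at q and multiplying by P_k(p) shows that q^M divides b [tm_sum] - a,
    for the sum with 2^(k+l) terms. *)
Lemma pade_err k l (A B C : {poly int}) M : (M <= 2 ^ l)%N ->
  B * tm_poly l = A + 'X^M * C ->
  err (pade_num k A) (pade_den k B) <= ((p ^ (2 ^ k * M))%N%:R)^-1.
Proof.
move=> Ml e; apply: (@err_le _ _ p_prime _ _ _ (2 ^ (k + l))).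
  by rewrite expnD leq_mul2l Ml orbT.
rewrite tm_sum_pow2 horner_tm_polyD /pade_num /pade_den natrX.
set x := _ ^+ (2 ^ k); have h := congr1 (fun f => f.[x]) e; rewrite !hornerE in h.
have gen (b t a0 P z : int) : b * t = a0 + z -> b * (P * t) - P * a0 = z * P.
  move=> bt; transitivity (P * (b * t) - P * a0); first by ring.
  by rewrite bt; ring.
rewrite (gen _ _ _ _ _ h) -mulrA.
have -> : x ^+ M = (p ^ (2 ^ k * M))%N%:Z by rewrite /x -exprM -natrX natz.
by rewrite abszM absz_nat dvdn_mulr.
Qed.

Lemma pade_compare k l (A B C : {poly int}) al be r s K :
  (al + be <= 2 ^ l)%N -> (size A <= al)%N -> (size B <= be.+1)%N ->
  B * tm_poly l = A + 'X^(al + be) * C ->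
  (poly_height A <= K)%N -> (poly_height B <= K)%N ->
  pade_num k A * s != pade_den k B * r ->
  (K * (q k ^ al * `|s| + q k ^ be * `|r|) < q k ^ (al + be))%N ->
  ((K * (q k ^ al * `|s| + q k ^ be * `|r|))%N%:R)^-1 <= err r s.
Proof.
move=> abl sA sB e hA hB ne lt; apply: (err_compare p_prime (pade_err k abl e) ne).
  have leA : (`|pade_num k A| <= K * q k ^ al)%N.
    case: al sA {abl e lt} => [|al] sA.
      by rewrite /pade_num (_ : A = 0) ?horner0 ?mulr0 //; apply/eqP; rewrite -size_poly_leq0.
    rewrite abszM expnS mulnCA leq_mul ?abs_tm_poly_le //.
    by rewrite (leq_trans (horner_height (q_gt0 k) sA)) // leq_mul2r hA orbT.
  have leB : (`|pade_den k B| <= K * q k ^ be)%N.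
    by rewrite (leq_trans (horner_height (q_gt0 k) sB)) // leq_mul2r hB orbT.
  by rewrite mulnDr !mulnA leq_add // leq_mul2r ?leA ?leB orbT.
by rewrite expnM.
Qed.

(** If (r, s) were proportional to both approximants, the determinant at q, a nonzero monomial,
    would vanish; so [pade_compare] applies to one of them. The exponents am and bm give a bound
    valid for either. *)
Lemma pade_pair_compare k l (A B C A' B' C' : {poly int}) al be al' be' am bm m c r s K :
  (al + be <= 2 ^ l)%N -> (size A <= al)%N -> (size B <= be.+1)%N ->
  B * tm_poly l = A + 'X^(al + be) * C ->
  (al' + be' <= 2 ^ l)%N -> (size A' <= al')%N -> (size B' <= be'.+1)%N ->
  B' * tm_poly l = A' + 'X^(al' + be') * C' ->
  c != 0 -> A * B' - A' * B = c *: 'X^m ->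
  (poly_height A <= K)%N -> (poly_height B <= K)%N ->
  (poly_height A' <= K)%N -> (poly_height B' <= K)%N -> (0 < K)%N ->
  s != 0 ->
  (K * (q k ^ al * `|s| + q k ^ be * `|r|) < q k ^ (al + be))%N ->
  (K * (q k ^ al' * `|s| + q k ^ be' * `|r|) < q k ^ (al' + be'))%N ->
  (al <= am)%N -> (al' <= am)%N -> (be <= bm)%N -> (be' <= bm)%N ->
  ((K * (q k ^ am * `|s| + q k ^ bm * `|r|))%N%:R)^-1 <= err r s.
Proof.
move=> abl sA sB e abl' sA' sB' e' c0 det hA hB hA' hB' K0 s0 lt lt' am1 am2 bm1 bm2.
have mono a b : (a <= am)%N -> (b <= bm)%N ->
    ((K * (q k ^ am * `|s| + q k ^ bm * `|r|))%N%:R : R)^-1 <=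
    ((K * (q k ^ a * `|s| + q k ^ b * `|r|))%N%:R)^-1.
  move=> aam bbm; have s1 : (0 < `|s|)%N by rewrite absz_gt0.
  have pos i j : (0 < K * (q k ^ i * `|s| + q k ^ j * `|r|))%N.
    by rewrite muln_gt0 K0 addn_gt0 muln_gt0 expn_gt0 q_gt0 s1.
  rewrite lef_pV2 ?posrE ?ltr0n // ler_nat leq_mul2l; apply/orP; right.
  by rewrite leq_add // leq_mul // leq_pexp2l ?q_gt0.
have [e1|ne] := eqVneq (pade_num k A * s) (pade_den k B * r); last first.
  exact: (le_trans (mono _ _ am1 bm1) (pade_compare abl sA sB e hA hB ne lt)).
have [e2|ne] := eqVneq (pade_num k A' * s) (pade_den k B' * r); last first.
  exact: (le_trans (mono _ _ am2 bm2) (pade_compare abl' sA' sB' e' hA' hB' ne lt')).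
have : (tm_poly k).[p%:R] * (A * B' - A' * B).[(q k)%:R] * s = 0.
  rewrite !hornerE; move: e1 e2; rewrite /pade_num /pade_den.
  set P := (tm_poly k).[_] => e1 e2.
  transitivity ((P * A.[(q k)%:R] * s) * B'.[(q k)%:R] - (P * A'.[(q k)%:R] * s) * B.[(q k)%:R]).
    by ring.
  by rewrite e1 e2; ring.
move/eqP; rewrite det !mulf_eq0 (negbTE s0) orbF -absz_eq0 eqn0Ngt abs_tm_poly_gt0 /=.
rewrite hornerZ hornerXn mulf_eq0 (negbTE c0) expf_eq0 /= => /andP[_].
by rewrite pnatr_eq0 eqn0Ngt q_gt0.
Qed.
End Pade.

(** * Explicit Pade approximants *)

(* With a = P_k(p) A(q), b = B(q), q = p^(2^k), a bound of al for the size of A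
   (not its degree) makes |a| at most a constant times q^al. *)
Definition is_pade l al be (A B : {poly int}) :=
  [/\ (al + be <= 2 ^ l)%N, (size A <= al)%N, (size B <= be.+1)%N &
      exists C, B * tm_poly l = A + 'X^(al + be) * C].

Definition pade_pair l al be al' be' := exists A B A' B' c m,
  [/\ is_pade l al be A B, is_pade l al' be' A' B', c != 0 &
      A * B' - A' * B = c *: 'X^m].

Lemma tm_poly4 : tm_poly 4 = (1 - 'X) * (1 - 'X^2) * (1 - 'X^4) * (1 - 'X^8).
Proof. by rewrite !tm_polyS /tm_poly big_ord0 mul1r. Qed.

Lemma polyC_int (c : int) : c%:P = c%:~R.
Proof. by rewrite -[c in LHS]intz rmorph_int. Qed.

Ltac poly_ring :=
  rewrite ?tm_poly4 /= ?cons_poly_def -?mul_polyC !polyC_int; ring.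

(* In each proof the polynomials are, in this order, the numerator and the
   denominator of either approximant; they solve small linear systems. *)
Lemma pade_pair_2_5_2_6 : pade_pair 4 2 5 2 6.
Proof.
exists (Poly [:: -2; 3]),
  (Poly [:: -2; 1; -1; 2; -2; 4]),
  (Poly [:: 1; -1]),
  (Poly [:: 1; 0; 1; 0; 2; 0; 2]),
  (6), 7%N; split => //.
- split=> //; try exact: size_Poly.
  by exists (Poly [:: -6; 8; -6; 0; 6; -4; 0; 0; 6; -6; 3; 0; -6; 4]); poly_ring.
- split=> //; try exact: size_Poly.
  by exists (Poly [:: -4; 4; 0; 0; 2; -2; 0; 0; 3; -3; 0; 0; -2; 2]); poly_ring.
- by poly_ring.
Qed.

Lemma pade_pair_2_6_2_7 : pade_pair 4 2 6 2 7.
Proof.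
exists (Poly [:: 1; -1]),
  (Poly [:: 1; 0; 1; 0; 2; 0; 2]),
  (Poly [:: -3; 5]),
  (Poly [:: -3; 2; -1; 4; -2; 8; 2; 12]),
  (-12), 8%N; split => //.
- split=> //; try exact: size_Poly.
  by exists (Poly [:: -4; 4; 0; 0; 2; -2; 0; 0; 3; -3; 0; 0; -2; 2]); poly_ring.
- split=> //; try exact: size_Poly.
  by exists (Poly [:: -20; 12; 0; 6; 10; -12; 0; 3; 15; -12; 0; -6; -10; 12]); poly_ring.
- by poly_ring.
Qed.

Lemma pade_pair_2_8_2_9 : pade_pair 4 2 8 2 9.
Proof.
exists (Poly [:: 1; -1]),
  (Poly [:: 1; 0; 1; 0; 2; 0; 2; 0; 4]),
  (Poly [:: -5; 7]),
  (Poly [:: -5; 2; -3; 4; -6; 8; -2; 12; -8; 20]),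
  (-20), 10%N; split => //.
- split=> //; try exact: size_Poly.
  by exists (Poly [:: -4; 4; -2; 2; 4; -4; -1; 1; 4; -4; 2; -2; -4; 4]); poly_ring.
- split=> //; try exact: size_Poly.
  by exists (Poly [:: -28; 30; -14; 0; 28; -15; -7; 0; 28; -30; 14; 0; -28; 20]); poly_ring.
- by poly_ring.
Qed.

Lemma pade_pair_4_6_4_7 : pade_pair 4 4 6 4 7.
Proof.
exists (Poly [:: -1; 1; 2; -2]),
  (Poly [:: -1; 0; 1; 0; 0; 0; 2]),
  (Poly [:: -1; -2; 1; 4]),
  (Poly [:: -1; -3; -3; -1; -2; -2; -2; 2]),
  (-4), 10%N; split => //.
- split=> //; try exact: size_Poly.
  by exists (Poly [:: -4; 4; 2; -2; 0; 0; 1; -1; 2; -2; -2; 2]); poly_ring.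
- split=> //; try exact: size_Poly.
  by exists (Poly [:: -8; 2; 4; -2; 0; 1; 2; -1; 4; -2; -4; 2]); poly_ring.
- by poly_ring.
Qed.

Lemma pade_pair_4_8_4_9 : pade_pair 4 4 8 4 9.
Proof.
exists (Poly [:: 1; -1; -1; 1]),
  (Poly [:: 1; 0; 0; 0; 1; 0; 0; 0; 2]),
  (Poly [:: 4; 1; -6; -1]),
  (Poly [:: 4; 5; 3; 3; 5; 6; 2; 2; 6; 8]),
  (8), 12%N; split => //.
- split=> //; try exact: size_Poly.
  by exists (Poly [:: -2; 2; 2; -2; -1; 1; 1; -1; 2; -2; -2; 2]); poly_ring.
- split=> //; try exact: size_Poly.
  by exists (Poly [:: -2; 12; 2; -12; -1; 6; 1; 0; 2; -12; -2; 8]); poly_ring.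
- by poly_ring.
Qed.

Lemma pade_pair_6_8_7_8 : pade_pair 4 6 8 7 8.
Proof.
exists (Poly [:: 2; -2; -1; 1; -2; 2]),
  (Poly [:: 2; 0; 1; 0; 1; 0; 0; 0; 2]),
  (Poly [:: 3; -2; -3; 1; -3; 2; 3]),
  (Poly [:: 3; 1; 1; 0; 0; -1; -1; -1; 2]),
  (-6), 14%N; split => //.
- split=> //; try exact: size_Poly.
  by exists (Poly [:: 2; -2; -2; 2; 1; -1; 2; -2; -2; 2]); poly_ring.
- split=> //; try exact: size_Poly.
  by exists (Poly [:: -2; -3; 2; 3; -1; 3; -2; -3; 2]); poly_ring.
- by poly_ring.
Qed.

(** * The lower bound *)

Section LowerBound.
Variables (R : realType) (p : nat) (p_prime : prime p).
Local Notation xi := (thue_morse_padic R p).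
Local Notation err a b := (padic_norm ((b : int)%:~R * xi - (a : int)%:~R)).
Local Notation q k := (p ^ (2 ^ k))%N.
Implicit Types (r s : int).

(** A lower bound of order |rs|^(-3/2); squaring the integer D removes the half-integral power, so
    that sizes are compared in [nat]. *)
Definition err_bound C r s := exists D, [/\ (0 < D)%N,
  (D ^ 2 <= C * (`|r| * `|s|) ^ 3)%N & (D%:R)^-1 <= err r s].

Lemma err_boundW C C' r s : (C <= C')%N -> err_bound C r s -> err_bound C' r s.
Proof.
move=> CC' [D [D0 DC De]]; exists D; split => //.
by apply: leq_trans DC _; rewrite leq_mul2r CC' orbT.
Qed.

Lemma size_condition (K u v Q al be : nat) :
  (0 < Q)%N -> (2 * K * u < Q ^ al)%N -> (2 * K * v < Q ^ be)%N ->
  (K * (Q ^ al * v + Q ^ be * u) < Q ^ (al + be))%N.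
Proof.
move=> Q0; rewrite expnD; have := expn_gt0 Q al; have := expn_gt0 Q be; rewrite Q0 /=.
move: (Q ^ al)%N (Q ^ be)%N => x y y0 x0 hu hv; nia.
Qed.

(** The squares of the two terms are at most (L u)^3 (L v) v^2 and (L u) (L v)^3 u^2, which both
    equal L^4 (u v)^3. *)
Lemma square_bound (K L Q u v i j am bm : nat) :
  (0 < Q)%N -> (2 * am <= 3 * i + j)%N -> (2 * bm <= i + 3 * j)%N ->
  (Q ^ i <= L * u)%N -> (Q ^ j <= L * v)%N ->
  ((K * (Q ^ am * v + Q ^ bm * u)) ^ 2 <= 4 * K ^ 2 * L ^ 4 * (u * v) ^ 3)%N.
Proof.
move=> Q0 ha hb hi hj.
have le_a : ((Q ^ am * v) ^ 2 <= L ^ 4 * (u * v) ^ 3)%N.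
  have : ((Q ^ am) ^ 2 <= (L * u) ^ 3 * (L * v))%N.
    apply: (@leq_trans ((Q ^ i) ^ 3 * Q ^ j)%N); last by rewrite leq_mul // leq_exp2r.
    by rewrite -!expnM -expnD leq_pexp2l //; lia.
  move=> h; rewrite expnMn; apply: leq_trans (leq_mul h (leqnn _)) _.
  by rewrite eq_leq //; ring.
have le_b : ((Q ^ bm * u) ^ 2 <= L ^ 4 * (u * v) ^ 3)%N.
  have : ((Q ^ bm) ^ 2 <= (L * u) * (L * v) ^ 3)%N.
    apply: (@leq_trans (Q ^ i * (Q ^ j) ^ 3)%N); last by rewrite leq_mul // leq_exp2r.
    by rewrite -!expnM -expnD leq_pexp2l //; lia.
  move=> h; rewrite expnMn; apply: leq_trans (leq_mul h (leqnn _)) _.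
  by rewrite eq_leq //; ring.
move: le_a le_b; set z := (L ^ 4 * _)%N; set x := (Q ^ am * v)%N; set y := (Q ^ bm * u)%N.
have -> : (4 * K ^ 2 * L ^ 4 * (u * v) ^ 3 = K ^ 2 * (4 * z))%N by rewrite /z; ring.
rewrite expnMn leq_mul2l => hx hy; apply/orP; right.
by move: x y z hx hy => x y z hx hy; nia.
Qed.

Lemma pade_pair_err l al be al' be' : pade_pair l al be al' be' ->
  exists K0, forall K, (K0 <= K)%N -> forall k r s, s != 0 ->
  (2 * K * `|r| < q k ^ minn al al')%N -> (2 * K * `|s| < q k ^ minn be be')%N ->
  ((K * (q k ^ maxn al al' * `|s| + q k ^ maxn be be' * `|r|))%N%:R)^-1 <= err r s.
Proof.
move=> [A [B [A' [B' [c [m [[le sA sB [C e]] [le' sA' sB' [C' e']] c0 det]]]]]]].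
exists (1 + poly_height A + poly_height B + poly_height A' + poly_height B')%N.
move=> K leK k r s s0 hr hs; have q0 := q_gt0 p_prime k.
have mono n x y : (n < q k ^ minn x y)%N -> (n < q k ^ x)%N /\ (n < q k ^ y)%N.
  by move=> h; split; apply: leq_trans h _; rewrite leq_pexp2l // ?geq_minl ?geq_minr.
have [hr1 hr2] := mono _ _ _ hr; have [hs1 hs2] := mono _ _ _ hs.
have lt := size_condition q0 hr1 hs1; have lt' := size_condition q0 hr2 hs2.
apply: (@pade_pair_compare R p p_prime k l A B C A' B' C' al be al' be' _ _ m c r s K
  le sA sB e le' sA' sB' e' c0 det _ _ _ _ _ s0 lt lt'); rewrite ?leq_maxl ?leq_maxr //; lia.
Qed.

Lemma pade_pair_bound l al be al' be' : pade_pair l al be al' be' ->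
  exists K0, forall K, (K0 <= K)%N -> forall k i j L r s, s != 0 ->
  (2 * K * `|r| < q k ^ minn al al')%N -> (2 * K * `|s| < q k ^ minn be be')%N ->
  (2 * maxn al al' <= 3 * i + j)%N -> (2 * maxn be be' <= i + 3 * j)%N ->
  (q k ^ i <= L * `|r|)%N -> (q k ^ j <= L * `|s|)%N ->
  err_bound (4 * K ^ 2 * L ^ 4) r s.
Proof.
case/pade_pair_err => K0 h; exists K0.+1 => K leK k i j L r s s0 hr hs ha hb hi hj.
have q0 := q_gt0 p_prime k; have s1 : (0 < `|s|)%N by rewrite absz_gt0.
exists (K * (q k ^ maxn al al' * `|s| + q k ^ maxn be be' * `|r|))%N; split.
- by rewrite muln_gt0 addn_gt0 muln_gt0 expn_gt0 q0 s1; lia.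
- exact: square_bound hi hj.
by apply: h => //; exact: ltnW.
Qed.

Definition good_num k : int := pade_num p k (1 - 'X^2 *+ 2).
Definition good_den k : int := pade_den p k (1 + 'X).

Lemma good_pade : (1 + 'X) * tm_poly 3 = (1 - 'X^2 *+ 2) + 'X^6 * (2%:R - 'X^2).
Proof.
have -> : tm_poly 3 = (1 - 'X) * (1 - 'X^2) * (1 - 'X^4).
  by rewrite !tm_polyS /tm_poly big_ord0 mul1r.
ring.
Qed.

Lemma good_err k : err (good_num k) (good_den k) <= ((p ^ (2 ^ k * 6))%N%:R)^-1.
Proof. exact: (@pade_err R p p_prime k 3 _ _ _ 6 isT good_pade). Qed.

Lemma good_denE k : `|good_den k|%N = (1 + q k)%N.
Proof. by rewrite /good_den /pade_den !hornerE natz; lia. Qed.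

Lemma good_numE k : `|good_num k|%N =
  (`|(tm_poly k).[p%:R : int]| * (2 * q k ^ 2 - 1))%N.
Proof.
rewrite /good_num /pade_num abszM; congr muln.
rewrite hornerD hornerN hornerMn hornerXn hornerC -natrX natz.
have : (0 < q k ^ 2)%N by rewrite expn_gt0 q_gt0.
by move: (q k ^ 2)%N => u; lia.
Qed.

Lemma good_num_le k : (`|good_num k| <= 2 * q k ^ 3)%N.
Proof.
rewrite good_numE; have := abs_tm_poly_le p_prime k; move: (`|_|)%N (q k) => u v h.
have -> : (2 * v ^ 3 = v * (2 * v ^ 2))%N by rewrite expnS mulnCA.
by rewrite leq_mul // leq_subr.
Qed.

Lemma good_den_lt_num k : (`|good_den k| < `|good_num k|)%N.
Proof.
rewrite good_numE good_denE; have := abs_tm_poly_gt0 p_prime k; have := q_ge2 p_prime k.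
by move: (`|_|)%N (q k) => u v; nia.
Qed.

(** With |a| <= 2 q^3 and |b| <= 2 q, the bounds on r and s make D smaller than q^6, as
    [err_compare] requires. The base Q with q = Q^m is there because the lower bounds on r and s
    come from an earlier index. *)
Lemma good_compare k i j m L Q r s : s != 0 -> q k = (Q ^ m)%N ->
  good_num k * s != good_den k * r ->
  (4 * `|s| < q k ^ 3)%N -> (4 * `|r| < q k ^ 5)%N ->
  (2 * (3 * m) <= 3 * i + j)%N -> (2 * m <= i + 3 * j)%N ->
  (Q ^ i <= L * `|r|)%N -> (Q ^ j <= L * `|s|)%N -> (0 < Q)%N ->
  err_bound (16 * L ^ 4) r s.
Proof.
move=> s0 qQ ne hs hr ha hb hi hj Q0; have q0 := q_gt0 p_prime k.
exists (2 * (Q ^ (3 * m) * `|s| + Q ^ m * `|r|))%N; split.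
- have s1 : (0 < `|s|)%N by rewrite absz_gt0.
  by rewrite muln_gt0 addn_gt0 muln_gt0 expn_gt0 Q0 s1.
- exact: (square_bound 2 Q0 ha hb hi hj).
rewrite [(3 * m)%N]mulnC expnM -qQ; apply: (err_compare p_prime (good_err k) ne).
  have := good_num_le k; rewrite good_denE; move: (`|good_num k|)%N (`|s|)%N (`|r|)%N.
  by move: q0; move: (q k) => v v0 x y z; nia.
rewrite expnM; move: q0 hs hr; move: (q k) (`|s|)%N (`|r|)%N => v x y v0 hs hr.
have -> : (v ^ 6 = v ^ 3 * v ^ 3)%N by rewrite -expnD.
have e : (v ^ 5 * v = v ^ 3 * v ^ 3)%N by rewrite -expnSr -expnD.
have v3 : (0 < v ^ 3)%N by rewrite expn_gt0 v0.
by rewrite -e; nia.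
Qed.

Lemma coprime_tm_poly k j h : (j <= k)%N -> odd h -> (h %| 1 + q k)%N ->
  coprime h `|(tm_poly j).[p%:R : int]|.
Proof.
move=> jk oh hk; elim: j jk => [|j ih] jk; first by rewrite horner_tm_poly big_ord0 coprimen1.
rewrite abs_tm_polyS // coprimeMr ih ?(ltnW jk) //=.
have [q0 q0'] := (q_gt0 p_prime j, q_gt0 p_prime k).
set g := gcdn h (q j - 1).
have g1 : (g %| 1 + q k)%N := dvdn_trans (dvdn_gcdl _ _) hk.
have g2 : (g %| q k - 1)%N.
  apply: dvdn_trans (dvdn_gcdr _ _) _; rewrite !subn1.
  by rewrite -(subnKC (ltnW jk)) expnD expnM dvdn_pred_predX.
have : (g %| 2)%N.
  have e2 v : (0 < v)%N -> (1 + v - (v - 1) = 2)%N by clear; lia.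
  by have := dvdn_sub g1 g2; rewrite e2.
have og : odd g by apply: dvdn_odd oh; exact: dvdn_gcdl.
by rewrite /coprime -/g; case: g og {g1 g2} => [|[|[|g]]] // _ /dvdn_leq; lia.
Qed.

(* b and a are coprime up to a factor 2, which is exact because 1 + q is
   either odd or 2 modulo 4. *)
Lemma good_coprime k : exists h e, [/\ coprime h `|good_num k.+1|,
  (1 + q k.+1 = e * h)%N, (0 < e)%N & (e <= 2)%N].
Proof.
have cop h : odd h -> (h %| 1 + q k.+1)%N -> coprime h `|good_num k.+1|.
  move=> oh hd; rewrite good_numE coprimeMr (coprime_tm_poly (leqnn _) oh hd) /=.
  apply: coprime_dvdl hd _; rewrite (_ : _ - 1 = 2 * (q k.+1 - 1) * (1 + q k.+1) + 1)%N.
    by rewrite /coprime gcdnMDl gcdn1.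
  by have := q_gt0 p_prime k.+1; move: (q k.+1) => v; nia.
(* The index [k.+1] makes q a square, so if odd it is 1 modulo 4 and 1 + q is twice an odd
   number. *)
have [oq|eq] := boolP (odd (q k)).
  have e : (q k = (q k)./2.*2.+1)%N by rewrite -{1}(odd_double_half (q k)) oq.
  have e2 : (1 + q k.+1 = 2 * (2 * ((q k)./2 ^ 2 + (q k)./2) + 1))%N.
    by rewrite qS [in LHS]e; move: ((q k)./2) => m; nia.
  exists (2 * ((q k)./2 ^ 2 + (q k)./2) + 1)%N, 2%N; split => //.
  by apply: cop; rewrite ?e2 ?dvdn_mull // oddD oddM.
exists (1 + q k.+1)%N, 1%N; rewrite mul1n; split => //; apply: cop => //.
by rewrite qS oddD oddX (negbTE eq).
Qed.

Lemma coprime_p_tm_poly k : coprime p `|(tm_poly k).[p%:R : int]|.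
Proof.
elim: k => [|k ih]; first by rewrite horner_tm_poly big_ord0 coprimen1.
rewrite abs_tm_polyS // coprimeMr ih /=; have q0 := q_gt0 p_prime k.
apply: (@coprime_dvdl _ (q k)); first by rewrite dvdn_exp // expn_gt0.
by rewrite subn1 -{1}(prednK q0) coprimeSn.
Qed.

(** The remainder is q^6 P_k(p) (2 - q^2), where p does not divide P_k(p) and p^2 does not divide 2
    - q^2. The additional exponent 2 accommodates p = 2. *)
Lemma good_err_gt k :
  ((p ^ (2 ^ k * 6 + 2))%N%:R)^-1 < err (good_num k) (good_den k).
Proof.
apply: (@err_ge R p p_prime _ _ _ (2 ^ (k + 3))%N).
  by rewrite expnD; have := expn_gt0 2 k; lia.
rewrite tm_sum_pow2 horner_tm_polyD /good_num /good_den /pade_num /pade_den natrX.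
set x := _ ^+ (2 ^ k); set P := (tm_poly k).[_].
have h := congr1 (fun f => f.[x]) good_pade; rewrite !hornerM in h.
have -> : (1 + 'X).[x] * (P * (tm_poly 3).[x]) - P * (1 - 'X^2 *+ 2).[x] =
    x ^+ 6 * (P * (2 - x ^+ 2)) :> int.
  transitivity (P * ((1 + 'X).[x] * (tm_poly 3).[x]) - P * (1 - 'X^2 *+ 2).[x]).
    by ring.
  rewrite h !(hornerD, hornerM, hornerN, hornerMn, hornerXn, hornerX, hornerC).
  ring.
have x2 : (p ^ 2 %| `|x ^+ 2|)%N by rewrite /x -exprM -natrX natz dvdn_exp2l // leq_pmull // expn_gt0.
rewrite abszM (_ : `|x ^+ 6|%N = (p ^ (2 ^ k * 6))%N); last by rewrite /x -exprM -natrX natz.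
rewrite expnD dvdn_pmul2l ?expn_gt0 ?prime_gt0 // abszM.
rewrite Gauss_dvdr; last by rewrite coprimeXl // coprime_p_tm_poly.
apply/negP => d2; have : (p ^ 2 %| 2)%N.
  have : ((p ^ 2)%N%:Z %| (2 - x ^+ 2) + x ^+ 2)%Z by rewrite rpredD // dvdzE.
  by rewrite subrK.
by move=> d; have := dvdn_leq (isT : (0 < 2)%N) d; have := prime_gt1 p_prime; nia.
Qed.

(** Coprimality forces h to divide s, whence e (r, s) = t (a, b) for an integer t. The error is then
    at least |t|_p times that of (a, b), while |rs| is at least of order t^2 q^4. *)
Lemma good_proportional k r s : s != 0 ->
  good_num k.+1 * s = good_den k.+1 * r ->
  err_bound (p ^ 4 * (4 * (p ^ 2 + 2)) ^ 3) r s.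
Proof.
move=> s0 e1; have [h [e [cop qe e0 e2]]] := good_coprime k.
have q0 := q_gt0 p_prime k.+1.
have denE : good_den k.+1 = e%:Z * h%:Z.
  by rewrite /good_den /pade_den !hornerE natz; lia.
have h0 : h%:Z != 0 by apply/eqP => hz; move: qe; lia.
have /dvdzP[t st] : (h %| s)%Z.
  rewrite dvdzE /= -(Gauss_dvdr _ cop) -abszM e1 denE -mulrA mulrCA abszM.
  by rewrite dvdn_mulr.
have t0 : t != 0 by apply: contra s0 => /eqP t0; rewrite st t0 mul0r.
have rt : good_num k.+1 * t = e%:Z * r.
  by apply: (mulIf h0); rewrite -mulrA -st e1 denE; ring.
have t1 : (0 < `|t|)%N by rewrite absz_gt0.
have p0 := prime_gt0 p_prime.
exists (`|t| * p ^ (2 ^ k.+1 * 6 + 2))%N; split.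
- by rewrite muln_gt0 t1 expn_gt0 p0.
- have aE : (`|good_num k.+1| * `|t| = e * `|r|)%N by rewrite -abszM rt abszM absz_nat.
  rewrite good_numE in aE.
  have sE : (e * `|s| = (1 + q k.+1) * `|t|)%N by rewrite st abszM absz_nat qe; lia.
  have := abs_tm_poly_ge p_prime k.+1.
  rewrite expnD expnM; move: aE sE q0 e0 e2 t1.
  move: (`|(tm_poly _).[_]|)%N (`|r|)%N (`|s|)%N (`|t|)%N (q k.+1) (p ^ 2 + 2)%N => u x y z v c.
  move=> aE sE v0 e0 e2 z0 uc.
  have hx : (u * v ^ 2 * z <= 2 * x)%N.
    apply: (@leq_trans (e * x)%N); last by rewrite leq_mul2r e2 orbT.
    by rewrite -aE leq_mul // leq_mul //; nia.
  have hy : (v * z <= 2 * y)%N.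
    apply: (@leq_trans (e * y)%N); last by rewrite leq_mul2r e2 orbT.
    by rewrite sE leq_mul.
  have h1 : (v ^ 4 * z <= 4 * c * (x * y))%N.
    have : (u * v ^ 2 * z * (v * z) <= 2 * x * (2 * y))%N by rewrite leq_mul.
    have -> : (u * v ^ 2 * z * (v * z) = u * (v ^ 3 * (z * z)))%N by ring.
    move=> h1; have h2 : (v ^ 3 * z <= v ^ 3 * (z * z))%N by rewrite leq_mul2l leq_pmulr ?orbT.
    apply: (@leq_trans (c * (u * (v ^ 3 * (z * z))))%N); last first.
      by apply: leq_trans (leq_mul (leqnn c) h1) _; rewrite eq_leq //; ring.
    rewrite mulnA; apply: (@leq_trans (v * (v ^ 3 * z))%N); first by rewrite mulnA -expnS.
    by rewrite leq_mul //; lia.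
  have h3 : ((v ^ 4 * z) ^ 3 <= (4 * c * (x * y)) ^ 3)%N by rewrite leq_exp2r.
  have h4 : ((v ^ 4) ^ 3 * z ^ 2 <= (v ^ 4 * z) ^ 3)%N.
    by rewrite expnMn leq_mul2l leq_pexp2l ?orbT.
  have -> : ((z * (v ^ 6 * p ^ 2)) ^ 2 = p ^ 4 * ((v ^ 4) ^ 3 * z ^ 2))%N by ring.
  have -> : (p ^ 4 * (4 * c) ^ 3 * (x * y) ^ 3 = p ^ 4 * (4 * c * (x * y)) ^ 3)%N by ring.
  by rewrite leq_mul // (leq_trans h4).
have eqn : e%:Z%:~R * (s%:~R * xi - r%:~R) =
    t%:~R * ((good_den k.+1)%:~R * xi - (good_num k.+1)%:~R) :> padic R p.
  have e3 := congr1 (fun z : int => z%:~R : padic R p) rt.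
  rewrite !rmorphM /= in e3; rewrite mulrBr -e3 st denE !rmorphM /=; ring.
have := congr1 (@padic_norm R p) eqn; rewrite !padic_normM => e4.
apply: (@le_trans _ _ (padic_norm (e%:Z%:~R : padic R p) * err r s)); last first.
  by rewrite ler_piMl ?padic_norm_ge0 // padic_norm_int_le1.
rewrite e4 natrM invfM ler_pM ?invr_ge0 ?ler0n ?padic_norm_int_ge //.
exact: ltW (good_err_gt _).
Qed.

Lemma ltn_q k : (k < q k)%N.
Proof.
apply: (ltn_trans (ltn_expl k (isT : (1 < 2)%N))).
by apply: ltn_expl; exact: prime_gt1.
Qed.

(* The six pairs cover all the positions of (r, s) with |r| <= |s| relative to
   the powers of q, where k is chosen so that |s| lies between q^4 and q^8. *)
Lemma err_bound_le : exists C, forall r s, r != 0 -> s != 0 ->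
  (`|r| <= `|s|)%N -> err_bound C r s.
Proof.
have [K1 h1] := pade_pair_bound pade_pair_2_5_2_6.
have [K2 h2] := pade_pair_bound pade_pair_2_6_2_7.
have [K3 h3] := pade_pair_bound pade_pair_2_8_2_9.
have [K4 h4] := pade_pair_bound pade_pair_4_6_4_7.
have [K5 h5] := pade_pair_bound pade_pair_4_8_4_9.
have [K6 h6] := pade_pair_bound pade_pair_6_8_7_8.
(* The factor p^4 in L serves the case k = 0, where minimality of k gives no lower bound on s. *)
pose K := (2 + K1 + K2 + K3 + K4 + K5 + K6)%N; pose L := (2 * K * p ^ 4)%N.
exists (4 * K ^ 2 * L ^ 4)%N => r s r0 s0 rs.
have {}h1 := h1 K ltac:(lia); have {}h2 := h2 K ltac:(lia).
have {}h3 := h3 K ltac:(lia); have {}h4 := h4 K ltac:(lia).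
have {}h5 := h5 K ltac:(lia); have {}h6 := h6 K ltac:(lia).
have K2le : (2 <= K)%N by rewrite /K; lia.
clearbody K; have p0 := prime_gt0 p_prime.
have KL : (2 * K <= L)%N by rewrite leq_pmulr // expn_gt0 p0.
have r1 : (0 < `|r|)%N by rewrite absz_gt0.
have s1 : (0 < `|s|)%N by rewrite absz_gt0.
have ex : exists k, (2 * K * `|s| < q k ^ 8)%N.
  exists (2 * K * `|s|)%N; have q1 := q_gt0 p_prime (2 * K * `|s|).
  by rewrite (leq_trans (ltn_q _)) // -[X in (X <= _)%N]expn1 leq_pexp2l.
case: (ex_minnP ex) => k s8 mink; have q0 := q_gt0 p_prime k.
have up u i : (q k ^ i <= 2 * K * u)%N -> (q k ^ i <= L * u)%N.
  by move=> h; apply: leq_trans h _; rewrite leq_mul2r KL orbT.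
have s4 : (q k ^ 4 <= L * `|s|)%N.
  case: k {s8 q0 up} mink => [|k] mink.
    by rewrite expn0 expn1 /L mulnAC leq_pmull // muln_gt0 s1; lia.
  have := contraNN (mink k); rewrite ltnn => /(_ isT); rewrite -leqNgt => h.
  rewrite qS -expnM; apply: leq_trans h _.
  by rewrite leq_mul2r KL orbT.
have r0' : (q k ^ 0 <= L * `|r|)%N by rewrite expn0 muln_gt0 r1; lia.
have rsK : (2 * K * `|r| <= 2 * K * `|s|)%N by rewrite leq_mul2l rs orbT.
(* For the positions where r is too close to s for the pairs. Here |r| <= |s| while |a| > |b|, so
   (r, s) is not proportional to (a, b). *)
have good m i j : q (k + m) = (q k ^ (2 ^ m))%N -> (2 * K * `|s| < q (k + m) ^ 3)%N ->
    (2 * (3 * 2 ^ m) <= 3 * i + j)%N -> (2 * 2 ^ m <= i + 3 * j)%N ->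
    (q k ^ i <= L * `|r|)%N -> (q k ^ j <= L * `|s|)%N -> err_bound (4 * K ^ 2 * L ^ 4) r s.
  move=> qm hs ha hb hi hj; apply: (@err_boundW (16 * L ^ 4)).
    by rewrite leq_mul2r; apply/orP; right; nia.
  have hs4 : (4 * `|s| < q (k + m) ^ 3)%N.
    by apply: leq_ltn_trans hs; rewrite leq_mul2r; apply/orP; right; lia.
  apply: (good_compare s0 qm _ hs4 _ ha hb hi hj q0).
    apply/eqP => e; have : (`|good_num (k + m)| * `|s| = `|good_den (k + m)| * `|r|)%N.
      by rewrite -!abszM e.
    by have := good_den_lt_num (k + m); nia.
  apply: leq_ltn_trans (_ : _ <= 4 * `|s|)%N _; first by rewrite leq_mul2l rs orbT.
  by apply: leq_trans hs4 _; rewrite leq_pexp2l // q_gt0.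
have q1 : q (k + 1) = (q k ^ (2 ^ 1))%N by rewrite -expnM -expnD.
have q2 : q (k + 2) = (q k ^ (2 ^ 2))%N by rewrite -expnM -expnD.
(* In the calls below, the two numbers after k are exponents i, j such that q^i and q^j bound |r|
   and |s| from below up to the factor L. *)
have [r2|/up r2] := ltnP (2 * K * `|r|) (q k ^ 2).
  have [s5|/up s5] := ltnP (2 * K * `|s|) (q k ^ 5).
    exact: (h1 k 0 4 L r s s0 r2 s5).
  have [s6|/up s6] := ltnP (2 * K * `|s|) (q k ^ 6).
    exact: (h2 k 0 5 L r s s0 r2 s6).
  exact: (h3 k 0 6 L r s s0 r2 s8).
have [r4|/up r4] := ltnP (2 * K * `|r|) (q k ^ 4).
  have [s6|/up s6] := ltnP (2 * K * `|s|) (q k ^ 6).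
    exact: (h4 k 2 4 L r s s0 r4 s6).
  exact: (h5 k 2 6 L r s s0 r4 s8).
have [s6|/up s6] := ltnP (2 * K * `|s|) (q k ^ 6).
  by apply: (good 1 4 4) => //; rewrite q1 -expnM.
have [r6|/up r6] := ltnP (2 * K * `|r|) (q k ^ 6).
  exact: (h6 k 4 6 L r s s0 r6 s8).
apply: (good 2 6 6) => //; rewrite q2 -expnM.
by apply: leq_trans s8 _; rewrite leq_pexp2l.
Qed.

(** Take the least k for which [good_compare] allows the index k + 1. Outside the proportional case,
    minimality gives |r| at least of order Q^5 or |s| at least of order Q^3 with Q = q_k; in the
    second case |r| >= |s| is as large. Both (5, 0) and (3, 3) satisfy 3i + j >= 12. *)
Lemma err_bound_ge : exists C, forall r s, r != 0 -> s != 0 ->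
  (`|s| <= `|r|)%N -> err_bound C r s.
Proof.
pose L := (4 * p ^ 5)%N.
exists (p ^ 4 * (4 * (p ^ 2 + 2)) ^ 3 + 16 * L ^ 4)%N => r s r0 s0 sr.
have ex : exists k, (4 * `|s| < q k.+1 ^ 3)%N && (4 * `|r| < q k.+1 ^ 5)%N.
  have lt : (4 * `|r| < q (4 * `|r|).+1)%N by apply: ltn_trans (ltn_q _).
  exists (4 * `|r|)%N; have q1 := q_gt0 p_prime (4 * `|r|).+1.
  have le m : (0 < m)%N -> (q (4 * `|r|).+1 <= q (4 * `|r|).+1 ^ m)%N.
    by move=> m0; rewrite -[X in (X <= _)%N]expn1 leq_pexp2l.
  by rewrite (leq_trans _ (le 3 isT)) ?(leq_trans _ (le 5 isT)) //; lia.
case: (ex_minnP ex) => k /andP[hs hr] mink.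
have r1 : (0 < `|r|)%N by rewrite absz_gt0.
have s1 : (0 < `|s|)%N by rewrite absz_gt0.
have p0 := prime_gt0 p_prime.
have L1 : (4 <= L)%N by rewrite leq_pmulr // expn_gt0 p0.
have [prop|ne] := eqVneq (good_num k.+1 * s) (good_den k.+1 * r).
  by apply: err_boundW (good_proportional s0 prop); rewrite leq_addr.
apply: (@err_boundW (16 * L ^ 4)); first by rewrite leq_addl.
have qk := q_gt0 p_prime k.
have [h|h] : (q k ^ 5 <= L * `|r|)%N \/ (q k ^ 3 <= 4 * `|s|)%N.
  case: k {hs hr ne qk} mink => [|k] mink.
    by left; rewrite expn0 expn1 /L mulnAC leq_pmull // muln_gt0 r1.
  have := contraNN (mink k); rewrite ltnn => /(_ isT); rewrite negb_and -!leqNgt.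
  case/orP => h; [right => // | left; apply: leq_trans h _].
  by rewrite leq_mul2r L1 orbT.
- apply: (good_compare (k := k.+1) (m := 2) (i := 5) (j := 0) s0 (qS p k)) => //.
  by rewrite expn0 muln_gt0 s1; lia.
- apply: (good_compare (k := k.+1) (m := 2) (i := 3) (j := 3) s0 (qS p k)) => //.
    by apply: leq_trans h _; rewrite leq_mul.
  by apply: leq_trans h _; rewrite leq_mul2r L1 orbT.
Qed.
End LowerBound.

(** * Lower bounds along a whole antidiagonal *)

Lemma pade_pair_adjacent l al be : (al.+1 + be = 2 ^ l)%N ->
  pade_pair l al.+1 be al be.+1.
Proof.
move=> abl; have abl' : (al + be.+1 = 2 ^ l)%N by rewrite addnS -addSn.
have [A [B [C [B0 sA sB e]]]] := tm_pade abl.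
have [A' [B' [C' [B0' sA' sB' e']]]] := tm_pade abl'.
have [c c0 det] := tm_pade_adjacent abl B0 B0' sA sB sA' sB' e e'.
exists A, B, A', B', c, (2 ^ l)%N; split=> //; split=> //; rewrite ?abl ?abl' //.
  by exists C.
by exists C'.
Qed.

Section UniformGap.
Variables (R : realType) (p : nat) (p_prime : prime p).
Local Notation xi := (thue_morse_padic R p).
Local Notation err a b := (padic_norm ((b : int)%:~R * xi - (a : int)%:~R)).
Local Notation q k := (p ^ (2 ^ k))%N.
Implicit Types (r s : int).

(** Here D = K (q^(al+1) |s| + q^(be+1) |r|), and the two size hypotheses put each term below half
    of q^(2^l). *)
Lemma adjacent_err l al be : (al.+1 + be = 2 ^ l)%N ->
  exists K0, forall K, (K0 <= K)%N -> forall k r s, s != 0 ->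
  (2 * K * `|r| < q k ^ al)%N -> (2 * K * `|s| < q k ^ be)%N ->
  ((q k ^ (2 ^ l))%N%:R)^-1 < err r s.
Proof.
move=> abl; have [K0 h] := pade_pair_err R p_prime (pade_pair_adjacent abl).
have [min1 min2] : minn al.+1 al = al /\ minn be be.+1 = be by lia.
have [max1 max2] : maxn al.+1 al = al.+1 /\ maxn be be.+1 = be.+1 by lia.
move: h; rewrite min1 min2 max1 max2 => h.
exists K0.+1 => K leK k r s s0 hr hs; have q0 := q_gt0 p_prime k.
apply: lt_le_trans (h K (ltnW leK) k r s s0 hr hs).
have s1 : (0 < `|s|)%N by rewrite absz_gt0.
have D0 : (0 < K * (q k ^ al.+1 * `|s| + q k ^ be.+1 * `|r|))%N.
  by rewrite muln_gt0 addn_gt0 muln_gt0 expn_gt0 q0 s1; lia.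
rewrite ltf_pV2 ?posrE ?ltr0n ?[(0 < q k ^ _)%N]expn_gt0 ?q0 //.
rewrite ltr_nat -abl addSn -addnS expnD expnS expnSr.
have := expn_gt0 (q k) al; have := expn_gt0 (q k) be; rewrite q0 /=.
move: hr hs q0; move: (q k ^ al)%N (q k ^ be)%N => x y; move: (q k) (`|r|)%N (`|s|)%N => v a b.
move=> hr hs v0 y0 x0.
have hx : (x * (2 * K * b) < x * y)%N by rewrite ltn_pmul2l.
have hy : (y * (2 * K * a) < y * x)%N by rewrite ltn_pmul2l.
have -> : (K * (v * x * b + y * v * a) = v * (K * (x * b) + K * (y * a)))%N by ring.
have -> : (x * (y * v) = v * (x * y))%N by ring.
rewrite ltn_pmul2l //; move: hx hy; rewrite [(y * x)%N]mulnC.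
by move: (x * y)%N => z; lia.
Qed.

(** Rounding |s| to a power of q selects a position on the antidiagonal. Of the lost factor q^4, one
    q pays for the rounding, two absorb the constant 2K, and one comes from al + 1 + be = 2^l. *)
Lemma uniform_gap l : (2 <= l)%N -> exists K, forall k r s,
  (K <= k)%N -> r != 0 -> s != 0 -> (`|r| * `|s| <= q k ^ (2 ^ l - 4))%N ->
  ((q k ^ (2 ^ l))%N%:R)^-1 < err r s.
Proof.
move=> l2; set N := (2 ^ l)%N.
have N4 : (4 <= N)%N by rewrite (leq_pexp2l (isT : (0 < 2)%N) l2).
have [K hK] : exists K, forall al be, (al.+1 + be = N)%N -> forall k r s, s != 0 ->
    (2 * K * `|r| < q k ^ al)%N -> (2 * K * `|s| < q k ^ be)%N ->
    ((q k ^ N)%N%:R)^-1 < err r s.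
  suff [K0 h] : exists K0, forall al be, (al < N)%N -> (al.+1 + be = N)%N ->
      forall K, (K0 <= K)%N -> forall k r s, s != 0 ->
      (2 * K * `|r| < q k ^ al)%N -> (2 * K * `|s| < q k ^ be)%N ->
      ((q k ^ N)%N%:R)^-1 < err r s.
    by exists K0 => al be abN; apply: (h al be _ abN K0 (leqnn _)); rewrite -abN leq_addr.
  (* Induction on a bound for al collects one constant for the finitely many positions. *)
  elim: {1}N => [|n [K1 h1]]; first by exists 0%N.
  have [nN|Nn] := ltnP n N; last by exists K1 => al be _ abN; apply: h1 => //; lia.
  have [K2 h2] := @adjacent_err l n (N - n.+1) (subnKC nN).
  exists (K1 + K2)%N => al be; rewrite ltnS leq_eqVlt => /orP[/eqP -> abN K leK|aln abN K leK].
    by rewrite (_ : be = (N - n.+1)%N); [apply: h2; lia | lia].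
  by apply: h1 => //; lia.
exists (2 * K)%N => k r s Kk r0 s0 rs.
have q2 := q_ge2 p_prime k; have q0 := q_gt0 p_prime k.
have Kq : (2 * K < q k)%N by apply: leq_ltn_trans Kk (ltn_q p_prime k).
have s1 : (0 < `|s|)%N by rewrite absz_gt0.
have r1 : (0 < `|r|)%N by rewrite absz_gt0.
have /andP[js sj] := trunc_log_bounds q2 s1; set j := trunc_log (q k) `|s| in js sj.
have rj : (`|r| * q k ^ j <= q k ^ (N - 4))%N.
  by apply: leq_trans rs; rewrite leq_mul2l js orbT.
have jN : (j <= N - 4)%N.
  by rewrite -(leq_exp2l _ _ q2) (leq_trans _ rj) // leq_pmull.
have rle : (`|r| <= q k ^ (N - 4 - j))%N.
  have qj : (0 < q k ^ j)%N by rewrite [(0 < q k ^ j)%N]expn_gt0 q0.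
  by rewrite -(leq_pmul2r qj) -expnD subnK.
apply: (hK (N - 3 - j)%N j.+2) => //; first by lia.
  rewrite (_ : N - 3 - j = (N - 4 - j).+1)%N; last by lia.
  rewrite expnS; apply: leq_trans (leq_mul (leqnn _) rle).
  by rewrite ltn_pmul2r.
by rewrite expnS ltn_mul.
Qed.
End UniformGap.

(** * The exponents *)

Lemma ereal_sup_threshold (R : realType) (S : set R) (c : R) :
  (forall x, x < c -> S x) -> (forall x, S x -> x <= c) ->
  ereal_sup [set x%:E | x in S] = c%:E.
Proof.
move=> lo up; apply/eqP; rewrite eq_le; apply/andP; split.
  by apply: ge_ereal_sup => _ [x Sx <-]; rewrite lee_fin up.
apply/lee_subgt0Pr => e e0; apply: ereal_sup_ubound.
by exists (c - e) => //; apply: lo; rewrite ltrBlDr ltrDl.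
Qed.

Lemma le_powR_root (R : realType) (A w e : R) : 0 < e -> 0 <= A ->
  A `^ e^-1 <= w -> A <= w `^ e.
Proof.
move=> e0 A0 h; rewrite -[leLHS]powRr1 // -(mulVf (lt0r_neq0 e0)) powRrM.
have r0 := powR_ge0 A e^-1.
by apply: ge0_ler_powR => //; rewrite ?nnegrE ?(ltW e0) // (le_trans r0).
Qed.

Section Exponents.
Variables (R : realType) (p : nat) (p_prime : prime p).
Local Notation xi := (thue_morse_padic R p).
Local Notation err a b := (padic_norm ((b : int)%:~R * xi - (a : int)%:~R)).
Local Notation q k := (p ^ (2 ^ k))%N.
Local Notation ht := (sqrt_absM R).
Implicit Types (a b r s : int).

Lemma sqr_sqrt_absM a b : ht a b ^+ 2 = (`|a| * `|b|)%N%:R.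
Proof. by rewrite sqr_sqrtr // -intr_norm -abszE -pmulrn abszM. Qed.

Lemma sqrt_absM_ge1 a b : a != 0 -> b != 0 -> 1 <= ht a b.
Proof.
move=> a0 b0; rewrite -(ler_pXn2r (n := 2)) ?nnegrE ?sqrtr_ge0 // expr1n sqr_sqrt_absM.
by rewrite ler1n muln_gt0 !absz_gt0 a0.
Qed.

Lemma absM_powR a b : `|(a * b)%:~R : R| `^ (- (3 / 2)) = (ht a b ^+ 3)^-1.
Proof.
have w0 : 0 <= ht a b by exact: sqrtr_ge0.
have -> : `|(a * b)%:~R : R| = ht a b `^ 2%:R by rewrite powR_mulrn // sqr_sqrtr.
by rewrite powRN -powRrM (_ : 2%:R * (3 / 2) = 3%:R) ?powR_mulrn //; lra.
Qed.

Lemma err_lower : exists2 c : R, 0 < c & forall r s, r != 0 -> s != 0 ->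
  c * (ht r s ^+ 3)^-1 < err r s.
Proof.
have [C1 h1] := err_bound_le R p_prime; have [C2 h2] := err_bound_ge R p_prime.
pose C : R := (C1 + C2)%N.+1%:R; have C0 : 0 < C by rewrite ltr0n.
(* The factor 2 makes the inequality strict. *)
exists (2 * C)^-1 => [|r s r0 s0]; first by rewrite invr_gt0 mulr_gt0.
have [D [D0 Dle De]] : err_bound R p (C1 + C2) r s.
  case/orP: (leq_total `|r| `|s|) => rs.
    by apply: err_boundW (h1 r s r0 s0 rs); rewrite leq_addr.
  by apply: err_boundW (h2 r s r0 s0 rs); rewrite leq_addl.
apply: lt_le_trans De; have w1 := sqrt_absM_ge1 r0 s0; set w := ht r s in w1 *.
have w0 : 0 < w by exact: lt_le_trans w1.
have w0' := ltW w0; have w3 : 0 < w ^+ 3 by rewrite exprn_gt0 // (lt_le_trans ltr01).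
rewrite -invfM ltf_pV2 ?posrE ?ltr0n ?mulr_gt0 //.
have DC : D%:R <= C * w ^+ 3.
  rewrite -(ler_pXn2r (n := 2)) ?nnegrE ?ler0n ?mulr_ge0 ?(ltW C0) ?(ltW w3) //.
  rewrite exprMn -exprM mulnC exprM sqr_sqrt_absM -!natrX -natrM ler_nat.
  apply: leq_trans Dle _; rewrite leq_mul2r; apply/orP; right; nia.
by apply: le_lt_trans DC _; rewrite -mulrA ltr_pMl ?mulr_gt0 // ltr1n.
Qed.

Lemma good_num_neq0 k : good_num p k != 0.
Proof. by rewrite -absz_gt0 (leq_ltn_trans _ (good_den_lt_num p_prime k)). Qed.

Lemma good_den_neq0 k : good_den p k != 0.
Proof. by rewrite -absz_gt0 good_denE. Qed.

(** From |ab| <= 4 q^4 the cube of the height is at most 8 q^6, and the error is at most q^(-6). *)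
Lemma good_err_height k :
  err (good_num p k) (good_den p k) <= 8 * (ht (good_num p k) (good_den p k) ^+ 3)^-1.
Proof.
apply: (le_trans (good_err R p_prime k)).
have w1 := sqrt_absM_ge1 (good_num_neq0 k) (good_den_neq0 k).
have w2 := sqr_sqrt_absM (good_num p k) (good_den p k).
set w := ht _ _ in w1 w2 *; have w0 : 0 < w by exact: lt_le_trans w1.
have w0' := ltW w0; have q1 := q_gt0 p_prime k.
have wq : w <= (2 * q k ^ 2)%N%:R.
  rewrite -(ler_pXn2r (n := 2)) ?nnegrE ?ler0n ?(ltW w0) // w2 -natrX ler_nat.
  have := good_num_le p_prime k; rewrite good_denE //; move: q1.
  move: (`|_|)%N (q k) => x v v0 hx.
  apply: (@leq_trans (2 * v ^ 3 * (2 * v))%N); first by rewrite leq_mul //; lia.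
  by rewrite eq_leq //; ring.
rewrite expnM ler_pdivlMr ?exprn_gt0 //.
have q6 : (0 < q k ^ 6)%N by rewrite (expn_gt0 (q k)) q1.
rewrite mulrC ler_pdivrMr ?ltr0n //.
apply: (@le_trans _ _ ((2 * q k ^ 2)%N%:R ^+ 3)); first by rewrite lerXn2r ?nnegrE ?(ltW w0).
by rewrite -natrX -natrM ler_nat eq_leq //; ring.
Qed.

Lemma good_height_ge k : (k%:R : R) < ht (good_num p k) (good_den p k) ^+ 2.
Proof.
rewrite sqr_sqrt_absM ltr_nat good_denE //; apply: (leq_trans (ltn_q p_prime k)).
rewrite (@leq_trans (1 * (1 + q k))%N) // ?mul1n ?leq_addl // leq_pmull //.
by rewrite absz_gt0 good_num_neq0.
Qed.

Lemma mult_exponent : mult_irrationality_exponent xi = 3%:E.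
Proof.
apply: ereal_sup_threshold => mu.
  move=> mu3 fin; have e0 : 0 < 3 - mu by rewrite subr_gt0.
  have [s es] := (finite_seqP _).1 fin.
  (* If the set were the finite list s, some [good_den] would exceed every denominator in it, with a
     height large enough to absorb the constant 8. *)
  have [k [kW kb]] : exists k, 8 `^ (3 - mu)^-1 <= ht (good_num p k) (good_den p k) /\
      forall ab : int * int, ab \in s -> (`|ab.2| < k)%N.
    pose W : R := 8 `^ (3 - mu)^-1; pose n := (\sum_(ab <- s) `|ab.2|)%N.
    exists (n.+1 + (Num.bound (W ^+ 2)))%N; split.
      have w0 : 0 <= ht (good_num p (n.+1 + Num.bound (W ^+ 2))) (good_den p (n.+1 + Num.bound (W ^+ 2))) by exact: sqrtr_ge0.
      rewrite -(ler_pXn2r (n := 2)) ?nnegrE ?powR_ge0 //.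
      apply: le_trans (ltW (good_height_ge _)).
      have := archi_boundP (sqr_ge0 W) => /ltW h; apply: (le_trans h).
      by rewrite ler_nat leq_addl.
    move=> ab abs; rewrite (leq_ltn_trans (n := n)) ?leq_addr // /n.
    by rewrite (big_rem ab) //= leq_addr.
  set a := good_num p k in kW; set b := good_den p k in kW.
  have a0 : a != 0 by exact: good_num_neq0.
  have b0 : b != 0 by exact: good_den_neq0.
  have w1 := sqrt_absM_ge1 a0 b0; set w := ht a b in kW w1.
  have w0 : 0 < w by exact: lt_le_trans w1.
  have [c c0 lower] := err_lower.
  have : (a, b) \in s.
    have : [set` s] (a, b); last by [].
    rewrite -es; split => //=.
      by apply: lt_trans (lower a b a0 b0); rewrite mulr_gt0 // invr_gt0 exprn_gt0.
    apply: (le_trans (good_err_height k)); rewrite -/a -/b -/w.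
    have -> : - mu = (3 - mu) + - 3%:R by lra.
    rewrite powRD; last by rewrite lt0r_neq0 ?w0 // implybT.
    rewrite powRN powR_mulrn ?(ltW w0) // ler_pM2r ?invr_gt0 ?exprn_gt0 //.
    exact: le_powR_root.
  move/kb; rewrite /= /b good_denE // ltnNge => /negP; apply.
  by rewrite ltnW // (ltn_trans (ltn_q p_prime k)).
move=> inf; rewrite leNgt; apply/negP => mu3; apply: inf.
have e0 : 0 < mu - 3 by rewrite subr_gt0.
have [c c0 lower] := err_lower.
(* For mu > 3, combining c w^(-3) with w^(-mu) forces the height w below W, which leaves finitely
   many pairs. *)
pose W : R := c^-1 `^ (mu - 3)^-1; pose n := Num.bound (W ^+ 2).
have fin : finite_set [set a : int | (`|a| <= n)%N].
  pose l : seq int := [seq i%:Z | i <- iota 0 n.+1] ++ [seq - i%:Z | i <- iota 0 n.+1].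
  apply: (@sub_finite_set _ _ [set` l]); last exact: finite_seq.
  move=> a an; have {}an : (`|a| \in iota 0 n.+1)%N by rewrite mem_iota ltnS.
  have : a \in l; last by [].
  rewrite mem_cat; apply/orP; case: (lerP 0 a) => a0; [left | right];
    by apply/mapP; exists `|a|%N => //; lia.
apply: sub_finite_set (finite_setX fin fin) => -[a b] /= [a0 b0 _ le].
have w1 := sqrt_absM_ge1 a0 b0; have w2 := sqr_sqrt_absM a b.
have := lt_le_trans (lower a b a0 b0) le; set w := ht a b in w1 w2 *.
have w0 : 0 < w by exact: lt_le_trans w1.
have -> : - mu = - (mu - 3) + - 3%:R by lra.
rewrite powRD; last by rewrite lt0r_neq0 ?w0 // implybT.
rewrite [_ `^ (- 3%:R)]powRN powR_mulrn ?(ltW w0) // ltr_pM2r ?invr_gt0 ?exprn_gt0 //.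
rewrite powRN => cw; have wW : w < W.
  rewrite ltNge; apply/negP => /(le_powR_root e0 (ltW _)) h.
  have := h; rewrite invr_gt0 => /(_ c0); rewrite leNgt => /negP; apply.
  by rewrite -[X in X < _]invrK ltf_pV2 ?posrE ?invr_gt0 ?powR_gt0.
have : (`|a| * `|b| <= n)%N.
  rewrite -(ler_nat R) -w2 (le_trans _ (ltW (archi_boundP (sqr_ge0 W)))) //.
  by rewrite lerXn2r ?nnegrE ?powR_ge0 ?(ltW w0) ?(ltW wW).
by rewrite -!absz_gt0 in a0 b0 => h; split => /=; apply: leq_trans h;
  rewrite ?leq_pmulr ?leq_pmull.
Qed.
End Exponents.

Lemma abs_thue_morse k : `|thue_morse k|%N = 1%N.
Proof.
rewrite /thue_morse; move: {1}k => n; elim: n k => //= n ih k.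
by case: odd; rewrite ?abszN ih.
Qed.

Lemma abs_tm_sum_lt p n : prime p -> (`|tm_sum p n| < p ^ n)%N.
Proof.
move=> pr; elim: n => [|n ih]; first by rewrite /tm_sum big_ord0.
rewrite /tm_sum big_ord_recr /= -/(tm_sum p n).
have tn : (`|(thue_morse n * p%:R ^+ n)%R| = p ^ n)%N.
  by rewrite abszM abs_thue_morse mul1n -natrX natz.
have le : (`|(tm_sum p n + thue_morse n * p%:R ^+ n)%R| <= `|tm_sum p n| + p ^ n)%N.
  by rewrite -tn; move: (tm_sum p n) (thue_morse n * _) => u v; lia.
apply: leq_ltn_trans le _; apply: (@leq_trans (2 * p ^ n)%N); first by lia.
by rewrite expnS leq_mul // prime_gt1.
Qed.

Section UniformExponent.
Variables (R : realType) (p : nat) (p_prime : prime p).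
Local Notation xi := (thue_morse_padic R p).
Local Notation q k := (p ^ (2 ^ k))%N.

Lemma tm_sum_neq0 n : (0 < n)%N -> tm_sum p n != 0.
Proof.
move=> n0; apply/eqP => z; have := @tm_sum_dvd p n 1 n0.
rewrite z sub0r abszN /tm_sum big_ord1 expr0 mulr1 /= expn1 dvdn1 => /eqP p1.
by have := prime_gt1 p_prime; rewrite p1.
Qed.

Lemma uniform_exponent : uniform_mult_irrationality_exponent xi = 2%:E.
Proof.
have p1 := prime_gt1 p_prime; have p0 := prime_gt0 p_prime.
apply: ereal_sup_threshold => mu.
  move=> mu2; have e0 : 0 < 2 - mu by rewrite subr_gt0.
  (* The second threshold gives X^(2 - mu) >= p, which absorbs the loss in rounding X^2 down to a
     power of p. *)
  exists (Num.max p%:R (p%:R `^ (2 - mu)^-1)) => X.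
  rewrite ge_max => /andP[pX rX].
  have X1 : 1 < X by apply: lt_le_trans pX; rewrite ltr1n.
  have X0 : 0 < X by exact: lt_trans X1.
  have /andP[tX Xt] := truncn_itv (sqr_ge0 X); set t := Num.truncn (X ^+ 2) in tX Xt.
  have pt : (p <= t)%N.
    rewrite -ltnS -(ltr_nat R); apply: le_lt_trans Xt; apply: (le_trans pX).
    by rewrite expr2 ler_peMr ?ltW.
  have /andP[nt tn] := trunc_log_bounds p1 (leq_trans p0 pt).
  set n := trunc_log p t in nt tn.
  have n0 : (0 < n)%N.
    by rewrite lt0n; apply: contraL tn => /eqP ->; rewrite expn1 -leqNgt.
  have w2 := @sqr_sqrt_absM R (tm_sum p n) 1.
  (* The truncation with p^n <= X^2 has numerator below p^n and error at most p^(-n). *)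
  exists (tm_sum p n), 1; split.
  - by rewrite (lt_le_trans ltr01) // sqrt_absM_ge1 // tm_sum_neq0.
  - rewrite -(ler_pXn2r (n := 2)) ?nnegrE ?sqrtr_ge0 ?(ltW X0) // w2 muln1.
    by rewrite (le_trans _ tX) // ler_nat (leq_trans _ nt) // ltnW // abs_tm_sum_lt.
  apply: (le_trans (@err_le R p p_prime _ _ n n (leqnn _) _)).
    by rewrite mul1r subrr.
  have -> : - mu = (2 - mu) + - 2%:R by lra.
  rewrite powRD; last by rewrite lt0r_neq0 ?implybT.
  rewrite powRN powR_mulrn ?(ltW X0) // ler_pdivlMr ?exprn_gt0 // mulrC.
  rewrite ler_pdivrMr ?ltr0n ?expn_gt0 ?p0 //.
  apply: (@le_trans _ _ (p ^ n.+1)%N%:R).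
    by apply: (le_trans (ltW Xt)); rewrite ler_nat.
  by rewrite expnS natrM ler_pM2r ?ltr0n ?expn_gt0 ?p0 // le_powR_root // ler0n.
move=> [X0 hX]; rewrite leNgt; apply/negP => mu2.
have e0 : 0 < mu - 2 by rewrite subr_gt0.
(* With N = 2^(m+3) and X = q^h, h = N/2 - 2, one has X^2 = q^(N-4) as in [uniform_gap]. The choice
   of m gives h (mu - 2) >= 4, so X^(-mu) <= q^(-N), a contradiction; k alone is used to make X
   exceed X0. *)
pose m := Num.bound (4 / (mu - 2)); pose h := (2 ^ m.+2 - 2)%N.
have m2 : (m.+2 < 2 ^ m.+2)%N by exact: ltn_expl.
have mh : (m < h)%N by rewrite /h; lia.
have N4 : (2 ^ m.+3 - 4 = h * 2)%N by rewrite /h expnS; lia.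
have NE : (2 ^ m.+3 = h * 2 + 4)%N by rewrite /h expnS; lia.
have [K gap] := uniform_gap R p_prime (isT : (2 <= m.+3)%N).
pose k := (K + Num.bound `|X0|)%N; have q0 := q_gt0 p_prime k.
pose X : R := (q k ^ h)%N%:R.
have q1 : 1 <= (q k)%:R :> R by rewrite ler1n.
have X0X : X0 <= X.
  apply: (le_trans (ler_norm _)); apply: (le_trans (ltW (archi_boundP (normr_ge0 _)))).
  rewrite ler_nat; apply: (@leq_trans (q k)).
    by rewrite (leq_trans _ (ltnW (ltn_q p_prime k))) // leq_addl.
  by rewrite -[X in (X <= _)%N]expn1 leq_pexp2l // (leq_trans _ mh).
have [a [b [w0 wX le]]] := hX X X0X.
have a0 : a != 0 by apply: contraL w0 => /eqP ->; rewrite /sqrt_absM mul0r normr0 sqrtr0 ltxx.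
have b0 : b != 0 by apply: contraL w0 => /eqP ->; rewrite /sqrt_absM mulr0 normr0 sqrtr0 ltxx.
have ab : (`|a| * `|b| <= q k ^ (2 ^ m.+3 - 4))%N.
  rewrite N4 -(ler_nat R) -(sqr_sqrt_absM R) expnM natrX.
  by rewrite lerXn2r ?nnegrE ?(ltW w0) ?ler0n.
have := lt_le_trans (gap k a b (leq_addr _ _) a0 b0 ab) le.
rewrite powRN ltf_pV2 ?posrE ?ltr0n ?powR_gt0 ?expn_gt0 ?p0 //; last first.
  by rewrite /X ltr0n (expn_gt0 (q k)) q0.
apply/negP; rewrite -leNgt NE.
have XE : X = (q k)%:R `^ h%:R by rewrite powR_mulrn ?ler0n // -natrX.
rewrite XE -powRrM natrX -powR_mulrn ?ler0n // ler_powR //.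
rewrite natrD natrM.
have : 4 <= h%:R * (mu - 2).
  rewrite -ler_pdivrMr // (le_trans (ltW (archi_boundP _))) ?divr_ge0 ?(ltW e0) //.
  by rewrite ler_nat -/m ltnW.
by rewrite mulrBr; lra.
Qed.
End UniformExponent.

Theorem theorem2p1 (R : realType) (p : nat) (p_prime : prime p) :
  [/\ mult_irrationality_exponent (thue_morse_padic R p) = 3%:E,
      uniform_mult_irrationality_exponent (thue_morse_padic R p) = 2%:E &
      exists c1 c2 : R,
        [/\ 0 < c1, 0 < c2,
            forall M : R, exists a b : int,
              [/\ a != 0, b != 0, M < `|(a * b)%:~R : R| &
                padic_norm (b%:~R * thue_morse_padic R p - a%:~R)
                  < c1 * `|(a * b)%:~R : R| `^ (- (3 / 2))] &
            forall r s : int, r != 0 -> s != 0 ->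
              c2 * `|(r * s)%:~R : R| `^ (- (3 / 2))
                < padic_norm (s%:~R * thue_morse_padic R p - r%:~R)]].
Proof.
split; [exact: mult_exponent | exact: uniform_exponent |].
have [c2 c2_gt0 lower] := err_lower R p_prime.
(* Any constant above the 8 of [good_err_height] yields the strict inequality. *)
exists 9, c2; split => // [M|r s r0 s0]; last by rewrite absM_powR lower.
pose k := Num.bound `|M|; exists (good_num p k), (good_den p k).
have a0 := good_num_neq0 p_prime k; have b0 := good_den_neq0 p_prime k; split => //.
  apply: (le_lt_trans (ler_norm _)); apply: (lt_trans (archi_boundP (normr_ge0 M))).
  by have := @good_height_ge R p p_prime k; rewrite sqr_sqrtr.
rewrite absM_powR; apply: (le_lt_trans (good_err_height R p_prime k)).
rewrite ltr_pM2r ?ltr_nat // invr_gt0 exprn_gt0 // (lt_le_trans ltr01) //.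
exact: sqrt_absM_ge1.
Qed.
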